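(* Let $n\ge 2$, let $c\in\mathbb{R}$, and let $\mathcal{C}$ be a catenoid in the space form $\overline{M}^{n+1}(c)$. Then the norm $|A|$ of the second fundamental form of $\mathcal{C}$ satisfies the Simons' equation $$|A|\,\Delta|A|+|A|^4=\frac{2}{n}\,\bigl|\nabla|A|\bigr|^2+nc\,|A|^2 .$$
   Context: Space form: $\overline{M}^{n+1}(c)$ is the simply connected complete $(n+1)$-dimensional Riemannian manifold of constant sectional curvature $c$: the round sphere $\mathbb{S}^{n+1}(c)$ of radius $1/\sqrt{c}$ in $\mathbb{R}^{n+2}$ if $c>0$, Euclidean space $\mathbb{R}^{n+1}$ if $c=0$, hyperbolic space of curvature $c$ if $c<0$. $A=(h_{ij})$ is the second fundamental form, $|A|^2=\sum_{i,j}h_{ij}^2$ in an orthonormal frame, and $\Delta$, $\nabla$ are the Laplacian (trace of the Hessian) and gradient of the induced metric on the hypersurface. Rotation hypersurface and catenoid: fix a geodesic $M^1\subset\overline{M}^{n+1}(c)$ (the rotation axis) and let $G\cong\mathrm{SO}(n)$ be the subgroup of the orientation-preserving isometry group of $\overline{M}^{n+1}(c)$ which fixes $M^1$ pointwise. A hypersurface (possibly only immersed) in $\overline{M}^{n+1}(c)$ invariant under $G$ is called a rotation hypersurface. A (connected) complete minimal rotation hypersurface is called a (spherical) catenoid; here ''complete'' means noncompact without boundary if $c\le 0$ and compact without boundary if $c>0$ (with complete induced metric). *)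

(* Defs.v *)
From mathcomp Require Import all_boot all_order all_algebra.
From mathcomp Require Import all_classical all_reals all_analysis.

Set Implicit Arguments.
Unset Strict Implicit.
Unset Printing Implicit Defensive.

Import Order.TTheory GRing.Theory Num.Theory.
Import numFieldNormedType.Exports.
Local Open Scope classical_set_scope.
Local Open Scope ring_scope.

Definition partial (R : realType) (n : nat) (V : normedModType R)
    (i : 'I_n) (f : 'rV[R]_n -> V) : 'rV[R]_n -> V :=
  fun u => 'D_(delta_mx 0 i) f u.

Definition iter_partial (R : realType) (n : nat) (V : normedModType R)
    (s : seq 'I_n) (f : 'rV[R]_n -> V) : 'rV[R]_n -> V :=
  foldr (fun i g => partial i g) f s.

Definition times_differentiable (R : realType) (n : nat) (V : normedModType R)
    (k : nat) (U : set 'rV[R]_n) (f : 'rV[R]_n -> V) : Prop :=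
  forall s : seq 'I_n, (size s < k)%N ->
    forall u, U u -> differentiable (iter_partial s f) u.

Definition smooth_on (R : realType) (n : nat) (V : normedModType R)
    (U : set 'rV[R]_n) (f : 'rV[R]_n -> V) : Prop :=
  forall k, times_differentiable k U f.

(* [chart_inv] is total; its values outside [chart_img] are irrelevant. *)
Record chart (R : realType) (n : nat) (M : topologicalType) := Chart {
  chart_dom : set M;
  chart_fun : M -> 'rV[R]_n;
  chart_inv : 'rV[R]_n -> M }.

Definition chart_img (R : realType) (n : nat) (M : topologicalType)
  (k : chart R n M) : set 'rV[R]_n := chart_fun k @` chart_dom k.

Definition is_chart (R : realType) (n : nat) (M : topologicalType)
    (k : chart R n M) : Prop :=
  [/\ open (chart_dom k), open (chart_img k),
      forall p, chart_dom k p -> chart_inv k (chart_fun k p) = p,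
      forall p, chart_dom k p -> {for p, continuous (chart_fun k)} &
      forall u, chart_img k u -> {for u, continuous (chart_inv k)}].

Definition compatible (R : realType) (n : nat) (M : topologicalType)
    (k l : chart R n M) : Prop :=
  smooth_on (chart_fun k @` (chart_dom k `&` chart_dom l))
            (chart_fun l \o chart_inv k).

(* Smooth n-manifolds without boundary. *)
Record manifold (R : realType) (n : nat) := Manifold {
  carrier :> topologicalType;
  atlas : set (chart R n carrier);
  manifold_hausdorff : hausdorff_space carrier;
  manifold_second_countable : @second_countable carrier;
  atlas_chart : forall k, atlas k -> is_chart k;
  atlas_cover : forall p, exists2 k, atlas k & chart_dom k p;
  atlas_compatible : forall k l, atlas k -> atlas l -> compatible k l }.

Section SpaceForm.
Variables (R : realType) (n : nat) (c : R).
Implicit Types (x y v : 'rV[R]_n.+2) (Q : 'M[R]_n.+2).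

(* Lorentzian on R^(n+2) if c < 0, Euclidean otherwise. *)
Definition inner x y : R :=
  (if c < 0 then -1 else 1) * (x 0 0 * y 0 0)
  + \sum_(j < n.+1) x 0 (lift ord0 j) * y 0 (lift ord0 j).

(* The sphere of radius 1/sqrt c if c > 0, one sheet of the hyperboloid
   <x,x> = 1/c if c < 0, and R^(n+1) as the affine hyperplane x_0 = 1 if c = 0:
   in all three cases isometries are restrictions of linear maps of R^(n+2),
   and geodesics are sections by planes through the origin. *)
Definition space_form : set 'rV[R]_n.+2 :=
  [set x : 'rV[R]_n.+2 | if c == 0 then x 0 0 = 1
           else inner x x = c^-1 /\ (c < 0 -> 0 < x 0 0)].

Definition tangent x v : Prop :=
  if c == 0 then v 0 0 = 0 else inner v x = 0.

Definition geodesic x v : set 'rV[R]_n.+2 :=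
  [set y : 'rV[R]_n.+2 | space_form y /\ exists a b : R, y = a *: x + b *: v].

Definition is_geodesic (L : set 'rV[R]_n.+2) : Prop :=
  exists x v, [/\ space_form x, tangent x v, inner v v = 1 & L = geodesic x v].

Definition isometry Q : Prop :=
  (forall x, space_form x -> space_form (x *m Q)) /\
  (forall x v, space_form x -> tangent x v ->
     inner (v *m Q) (v *m Q) = inner v v).

(* An isometry Q preserves the orientation of the space form iff det Q > 0: the
   direction normal to the space form (x if c <> 0, and R^(n+2) modulo
   {v_0 = 0} if c = 0) is mapped to the corresponding one at x Q. *)
Definition axis_group (L : set 'rV[R]_n.+2) : set 'M[R]_n.+2 :=
  [set Q | [/\ isometry Q, 0 < \det Q & forall x, L x -> x *m Q = x]].

Section LocalGeometry.
(* A local parametrization of a hypersurface of the space form. *)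
Variable X : 'rV[R]_n -> 'rV[R]_n.+2.
Implicit Types (u : 'rV[R]_n) (f : 'rV[R]_n -> R).

Definition jacobian u : 'M[R]_(n, n.+2) := \matrix_(i < n) partial i X u.

Definition metric u : 'M[R]_n :=
  \matrix_(i, j) inner (partial i X u) (partial j X u).

Definition christoffel (k i j : 'I_n) u : R :=
  2^-1 * \sum_l invmx (metric u) k l *
    (partial i (fun w => metric w j l) u
     + partial j (fun w => metric w i l) u
     - partial l (fun w => metric w i j) u).

Definition gradient f u : 'rV[R]_n :=
  (\row_j partial j f u) *m invmx (metric u).

Definition sqnorm_gradient f u : R :=
  (gradient f u *m metric u *m (gradient f u)^T) 0 0.

Definition hessian f u : 'M[R]_n :=
  \matrix_(i, j) (partial i (partial j f) u
                  - \sum_k christoffel k i j u * partial k f u).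

Definition laplacian f u : R := \tr (invmx (metric u) *m hessian f u).

Definition unit_normal u : set 'rV[R]_n.+2 :=
  [set N | [/\ tangent (X u) N, inner N N = 1 &
               forall i, inner N (partial i X u) = 0]].

(* One of the two opposite unit normals: [second_form] is determined up to
   sign, and minimality and |A| do not depend on the choice. *)
Definition normal u : 'rV[R]_n.+2 := xget 0 (unit_normal u).

(* The normal is tangent to the space form, so the derivatives in R^(n+2) may
   be used in place of the covariant derivatives of the space form. *)
Definition second_form u : 'M[R]_n :=
  \matrix_(i, j) inner (partial i (partial j X) u) (normal u).

Definition mean_curvature u : R :=
  \tr (invmx (metric u) *m second_form u).

(* sum of g^{ik} g^{jl} h_ij h_kl; see [sqnormA_orthonormal] *)
Definition sqnormA u : R :=
  \tr (invmx (metric u) *m second_form u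
       *m invmx (metric u) *m (second_form u)^T).

Definition normA u : R := Num.sqrt (sqnormA u).

(* The rows of E are the coordinates of an orthonormal frame at u. *)
Lemma sqnormA_orthonormal u (E : 'M[R]_n) :
  E *m metric u *m E^T = 1%:M ->
  sqnormA u = \sum_i \sum_j ((E *m second_form u *m E^T) i j) ^+ 2.
Proof.
rewrite /sqnormA; move: (metric u) (second_form u) => g h EgE.
have [uE ugE] : E \in unitmx /\ g *m E^T \in unitmx.
  by apply: mulmx1_unit; rewrite mulmxA.
have ug : g \in unitmx by move: ugE; rewrite unitmx_mul => /andP[].
have -> : invmx g = E^T *m E.
  have /mulmx1C EE : E *m (g *m E^T) = 1%:M by rewrite mulmxA.
  by rewrite -[LHS]mulmx1 -EE !mulmxA mulVmx// mul1mx.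
rewrite -!mulmxA mxtrace_mulC !mulmxA.
rewrite -[X in \tr X](_ : (E *m h *m E^T) *m (E *m h *m E^T)^T = _); last first.
  by rewrite !trmx_mul trmxK !mulmxA.
rewrite /mxtrace; apply: eq_bigr => i _; rewrite !mxE.
by apply: eq_bigr => j _; rewrite [X in _ * X]mxE expr2.
Qed.

End LocalGeometry.

Section Hypersurface.
Variables (M : manifold R n) (F : M -> 'rV[R]_n.+2).

Definition hypersurface : Prop :=
  (forall p, space_form (F p)) /\
  (forall k, atlas k ->
     smooth_on (chart_img k) (F \o chart_inv k) /\
     forall u, chart_img k u -> row_free (jacobian (F \o chart_inv k) u)).

Definition minimal : Prop :=
  forall k, atlas k ->
    forall u, chart_img k u -> mean_curvature (F \o chart_inv k) u = 0.

(* As F is only an immersion, this is invariance of the image: a G-action on M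
   making F equivariant is not required. *)
Definition rotational : Prop :=
  exists2 L, is_geodesic L &
    forall Q, axis_group L Q -> forall p, range F (F p *m Q).

(* C^1 curves on R, of which only the restriction to [0, 1] is used below: a
   piecewise C^1 curve on [0, 1] becomes one of these, with the same length, by
   a reparametrization that stops at the corners and at the end points. *)
Definition c1_curve (gamma : R -> M) : Prop :=
  continuous gamma /\
  forall k, atlas k -> forall t, chart_dom k (gamma t) ->
    (\forall s \near t, derivable (chart_fun k \o gamma) s 1) /\
    {for t, continuous (derive1 (chart_fun k \o gamma))}.

Definition curve_length (gamma : R -> M) : R :=
  \int[lebesgue_measure]_(t in `[0, 1])
    Num.sqrt (inner (derive1 (F \o gamma) t) (derive1 (F \o gamma) t)).

Definition induced_distance (p q : M) : R :=
  inf [set curve_length gamma | gamma in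
         [set gamma | [/\ c1_curve gamma, gamma 0 = p & gamma 1 = q]]].

Definition complete_metric : Prop :=
  forall x : nat -> M,
    (forall e : R, 0 < e -> exists N : nat, forall i j : nat,
       (N <= i)%N -> (N <= j)%N -> induced_distance (x i) (x j) < e) ->
    exists p, induced_distance (x i) p @[i --> \oo] --> (0 : R).

Definition catenoid : Prop :=
  [/\ hypersurface, minimal & rotational] /\
  [/\ connected [set: M], [set: M] !=set0, complete_metric &
      if 0 < c then compact [set: M] else ~ compact [set: M]].

(* In every chart of M, |A| is twice differentiable and satisfies the equation. *)
Definition simons_equation : Prop :=
  forall k, atlas k ->
    let X := F \o chart_inv k in
    times_differentiable 2 (chart_img k) (normA X) /\
    forall u, chart_img k u ->
      normA X u * laplacian X (normA X) u + normA X u ^+ 4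
      = 2 / n%:R * sqnorm_gradient X (normA X) u + n%:R * c * normA X u ^+ 2.

End Hypersurface.
End SpaceForm.

(* Main.v *)
(* The image of F, an immersed n-manifold with countable topology, is invariant
   under the rotations around the axis, and by Baire's theorem this forces the
   Killing fields of the rotations to be tangent to every sheet of F.

   Let z be the R^n-valued coordinates orthogonal to the axis, rho = |z|^2 and
   nu = <z, w> with w the projection of the unit normal. Tangency of the Killing
   fields means rho w = nu z, and differentiating it shows that the second
   fundamental form plus (nu / rho) times the metric has rank at most one off the
   axis. By minimality the principal curvatures are then -nu / rho with
   multiplicity n - 1 and (n - 1) nu / rho, so |A|^2 = n (n - 1) nu^2 / rho^2.
   Differentiating |grad rho|^2 = 4 (rho - nu^2 - c rho^2) shows that
   nu^2 rho^(n-2) is locally constant. Where it vanishes, A = 0, because the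
   preimage of the axis has empty interior; elsewhere |A| is a constant times
   rho^(-n/2), and the equation follows from the Hessian of rho. *)

Require Import Defs.
From HB Require Import structures.
From mathcomp Require Import all_boot all_order all_algebra.
From mathcomp Require Import all_classical all_reals all_analysis.
From mathcomp Require Import ring lra.

Set Implicit Arguments.
Unset Strict Implicit.
Unset Printing Implicit Defensive.

Import Order.TTheory GRing.Theory Num.Theory.
Import numFieldNormedType.Exports.
Local Open Scope classical_set_scope.
Local Open Scope ring_scope.

(** The field [normal] is chosen point by point, with no continuity, so neither nu nor [second_form]
    may be differentiated. Every quantity that is differentiated is free of that choice: the
    tangency of a Killing field is paired with the normal frozen at one point, nu^2 is recovered as
    the differentiable expression rho - c rho^2 - |grad rho|^2 / 4, and the vanishing of A is
    carried to points of the axis by the continuity of the normal part of the second derivatives of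
    the immersion. The exponents have one origin. The gradient of rho is a principal direction with
    curvature (n - 1) nu / rho, and inserting this in the derivative of |grad rho|^2 gives rho
    grad(nu^2) = -(n - 2) nu^2 grad rho. Hence nu^2 is a constant times rho^(2 - n), and nu^2 /
    rho^2 a constant times rho^(-n). *)

Lemma near_eq_differentiable (R : numFieldType) (V W : normedModType R)
    (f g : V -> W) (a : V) :
  (\near a, f a = g a) -> differentiable f a -> differentiable g a.
Proof.
move=> fg df.
have ga : g a = f a by rewrite (nbhs_singleton fg).
have gdf : g \o shift a = cst (g a) + 'd f a +o_ 0 id.
  apply/eqaddoP => e e0; have /eqaddoP/(_ e e0) := diff_locally df.
  apply: filter_app; have := fg; rewrite (near_shift 0 a) subr0 /=.
  apply: filter_app; near=> h => /= fgh; rewrite /= ga.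
  by rewrite [(_ - _) h]/= -[X in _ -> `|X| <= _]/(g (h + a) - _) -fgh.
apply/diff_locallyP; rewrite (diff_unique _ gdf); last exact: diff_continuous.
by split => //; exact: diff_continuous.
Unshelve. all: by end_near. Qed.

(** * Calculus of gradients of real functions *)

Section Calculus.
Context (R : realType) (n : nat).
Implicit Types (f g : 'rV[R]_n -> R) (u v : 'rV[R]_n) (d e : 'I_n -> R).

(** Bundled so that each rule yields both differentiability and the partial derivatives;
    [has_gradient_eq] then brings the latter into the wanted form. *)
Definition has_gradient f u d :=
  differentiable f u /\ forall i, partial i f u = d i.

Lemma derive_sum_partial (V : normedModType R) (f : 'rV[R]_n -> V) u v :
  differentiable f u -> 'D_v f u = \sum_i v 0 i *: partial i f u.
Proof.
move=> df; rewrite deriveE// {1}[v]row_sum_delta linear_sum/=.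
by apply: eq_bigr => i _; rewrite linearZ/= /partial deriveE.
Qed.

Lemma has_gradientP f u : differentiable f u ->
  has_gradient f u (fun i => partial i f u).
Proof. by []. Qed.

Lemma has_gradient_eq f u d e :
  has_gradient f u d -> d =1 e -> has_gradient f u e.
Proof. by move=> [df fd] de; split=> // i; rewrite fd. Qed.

Lemma has_gradient_near f g u d :
  (\near u, f u = g u) -> has_gradient f u d -> has_gradient g u d.
Proof.
move=> fg [df fd]; split; first exact: near_eq_differentiable df.
by move=> i; rewrite -fd; apply/esym/near_eq_derive.
Qed.

Lemma has_gradient_cst (a : R) u : has_gradient (fun=> a) u (fun=> 0).
Proof. by split=> [|i]; [exact: differentiable_cst | exact: derive_cst]. Qed.

Lemma has_gradientD f g u d e : has_gradient f u d -> has_gradient g u e ->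
  has_gradient (fun w => f w + g w) u (fun i => d i + e i).
Proof.
move=> [df fd] [dg ge]; split; first exact: differentiableD.
by move=> i; rewrite -fd -ge /partial -deriveD//; exact: diff_derivable.
Qed.

Lemma has_gradientM f g u d e : has_gradient f u d -> has_gradient g u e ->
  has_gradient (fun w => f w * g w) u (fun i => d i * g u + f u * e i).
Proof.
move=> [df fd] [dg ge]; split; first exact: differentiableM.
move=> i; rewrite -fd -ge /partial deriveM; [|exact: diff_derivable..].
by rewrite /= addrC; congr (_ + _); rewrite mulrC.
Qed.

Lemma has_gradient_comp (h : R -> R) (dh : R) f u d :
  is_derive (f u) 1 h dh -> has_gradient f u d ->
  has_gradient (fun w => h (f w)) u (fun i => dh * d i).
Proof.
move=> [hd hdh] [df fd]; have dh' : differentiable h (f u) by exact/derivable1_diffP.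
split; first exact: differentiable_comp.
move=> i; rewrite -fd /partial deriveE; last exact: differentiable_comp.
by rewrite diff_comp//= deriv1E//= derive1E hdh deriveE// mulrC.
Qed.

Lemma has_gradientZ (a : R) f u d : has_gradient f u d ->
  has_gradient (fun w => a * f w) u (fun i => a * d i).
Proof.
move=> fd; apply: has_gradient_eq (has_gradientM (has_gradient_cst a u) fd) _.
by move=> i /=; rewrite mul0r add0r.
Qed.

Lemma has_gradientB f g u d e : has_gradient f u d -> has_gradient g u e ->
  has_gradient (fun w => f w - g w) u (fun i => d i - e i).
Proof.
move=> fd ge; have := has_gradientD fd (has_gradientZ (-1) ge).
rewrite (_ : (fun w => _) = (fun w => f w - g w)); last first.
  by apply/funext => w; rewrite mulN1r.
by move=> h; apply: has_gradient_eq h _ => i; rewrite mulN1r.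
Qed.

Lemma has_gradient_sum (I : Type) (r : seq I) (F : I -> 'rV[R]_n -> R) u
    (D : I -> 'I_n -> R) :
  (forall j, has_gradient (F j) u (D j)) ->
  has_gradient (fun w => \sum_(j <- r) F j w) u (fun i => \sum_(j <- r) D j i).
Proof.
move=> FD; elim: r => [|j r IH].
  apply: has_gradient_eq; last by move=> i; rewrite big_nil.
  rewrite (_ : (fun w => _) = fun=> 0); first exact: has_gradient_cst.
  by apply/funext => w; rewrite big_nil.
apply: has_gradient_eq; last by move=> i; rewrite big_cons.
rewrite (_ : (fun w => _) = fun w => F j w + \sum_(j <- r) F j w).
  exact: has_gradientD.
by apply/funext => w; rewrite big_cons.
Qed.

Lemma has_gradient_coord m (f : 'rV[R]_n -> 'rV[R]_m) u j :
  differentiable f u ->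
  has_gradient (fun w => f w 0 j) u (fun i => partial i f u 0 j).
Proof.
move=> df; split; first exact: (differentiable_comp df (differentiable_coord _ _ _)).
by move=> i; rewrite /partial derive_mx ?mxE//; exact: diff_derivable.
Qed.

Lemma differentiable_prod (I : Type) (r : seq I) (F : I -> 'rV[R]_n -> R) u :
  (forall j, differentiable (F j) u) ->
  differentiable (fun w => \prod_(j <- r) F j w) u.
Proof.
move=> dF; elim: r => [|j r IH].
  rewrite (_ : (fun w => _) = fun=> 1); first exact: differentiable_cst.
  by apply/funext => w; rewrite big_nil.
rewrite (_ : (fun w => _) = fun w => F j w * \prod_(j <- r) F j w).
  exact: differentiableM.
by apply/funext => w; rewrite big_cons.
Qed.

Lemma differentiable_det m (A : 'rV[R]_n -> 'M[R]_m) u :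
  (forall i j, differentiable (fun w => A w i j) u) ->
  differentiable (fun w => \det (A w)) u.
Proof.
move=> dA; rewrite /determinant.
by apply: (proj1 (has_gradient_sum _ (fun s => has_gradientP _))) => s;
  apply: differentiableM; [exact: differentiable_cst | exact: differentiable_prod].
Qed.

(** Cramer's rule: on invertible matrices [invmx] is the adjugate formula. Invertibility is asked
    near [u] because the two expressions have to agree on a neighbourhood. *)
Lemma differentiable_invmx m (A : 'rV[R]_n -> 'M[R]_m) u i j :
  (\near u, A u \in unitmx) ->
  (forall i j, differentiable (fun w => A w i j) u) ->
  differentiable (fun w => invmx (A w) i j) u.
Proof.
move=> uA dA; apply: (@near_eq_differentiable _ _ _
  (fun w => (\det (A w))^-1 * ((-1) ^+ (j + i) * \det (row' j (col' i (A w)))))).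
  by near=> w; rewrite /invmx (near uA w)//= !mxE.
apply: differentiableM.
  apply: differentiableV; first exact: differentiable_det.
  by rewrite -unitfE -unitmxE; exact: nbhs_singleton uA.
apply: differentiableM; first exact: differentiable_cst.
apply: differentiable_det => k l.
rewrite (_ : (fun w => _) = fun w => A w (lift j k) (lift i l)); first exact: dA.
by apply/funext => w; rewrite !mxE.
Unshelve. all: by end_near. Qed.

End Calculus.

(** * Mean value theorem and symmetry of second derivatives *)

Section MeanValue.
Context (R : realType) (n : nat).
Implicit Types (f : 'rV[R]_n -> R) (u v : 'rV[R]_n).

Lemma norm_delta_mx (i : 'I_n) : `|delta_mx 0 i : 'rV[R]_n| <= 1.
Proof.
rewrite /Num.Def.normr/= mx_normrE; apply: bigmax_le => //= -[a b] _.
by rewrite mxE; case: (_ && _); rewrite ?normr1 ?normr0.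
Qed.

Lemma is_derive_line (V W : normedModType R) (f : V -> W) (u v : V) (t : R) :
  differentiable f (u + t *: v) ->
  is_derive t 1 (fun s => f (u + s *: v)) ('D_v f (u + t *: v)).
Proof.
move=> df.
have line : is_derive t 1 (fun s : R => u + s *: v) v.
  have : is_derive t 1 (cst u + (fun s : R => s *: v)) (0 + v).
    apply: is_deriveD; split; first exact/derivable1_diffP.
    by rewrite deriveE// diff_val scale1r.
  by rewrite add0r.
have dl : differentiable (fun s : R => u + s *: v) t.
  by apply/derivable1_diffP; case: line.
split; first by apply/derivable1_diffP; exact: (differentiable_comp dl).
rewrite deriveE; last exact: (differentiable_comp dl).
by rewrite (diff_comp dl)//= -[X in 'd f _ X]deriveE// derive_val deriveE.
Qed.

Lemma mean_value f u v :
  (forall t, 0 <= t <= 1 -> differentiable f (u + t *: v)) ->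
  exists2 t, 0 <= t <= 1 & f (u + v) - f u = 'D_v f (u + t *: v).
Proof.
move=> df; have [|||t] := @MVT_segment R (fun t => f (u + t *: v))
  (fun t => 'D_v f (u + t *: v)) 0 1.
- exact: ler01.
- move=> t; rewrite in_itv/= => /andP[t0 t1]; apply: is_derive_line.
  by apply: df; rewrite !ltW.
- apply: derivable_within_continuous => t; rewrite in_itv/= => t01.
  by case: (is_derive_line (df t t01)).
by rewrite in_itv/= => t01; rewrite scale1r scale0r addr0 subr0 mulr1; exists t.
Qed.

End MeanValue.

Section Schwarz.
Context (R : realType) (n : nat).
Implicit Types (f : 'rV[R]_n -> R) (u v : 'rV[R]_n).

Lemma second_difference f (i j : 'I_n) u (d s : R) : 0 < s -> 2 * s < d ->
  (forall w, ball u d w -> differentiable f w /\ differentiable (partial i f) w) ->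
  let a : 'rV[R]_n := s *: delta_mx 0 i in
  let b : 'rV[R]_n := s *: delta_mx 0 j in
  exists2 w, ball u d w &
    (f (u + a + b) - f (u + a)) - (f (u + b) - f u)
    = s ^+ 2 * partial j (partial i f) w.
Proof.
move=> s0 sd hf a b.
have inb (x y : R) : 0 <= x <= 1 -> 0 <= y <= 1 -> ball u d (u + x *: a + y *: b).
  move=> /andP[x0 x1] /andP[y0 y1].
  rewrite -ball_normE /ball_/= -addrA opprD addrA subrr sub0r normrN.
  apply: le_lt_trans sd; rewrite mulrDl !mul1r (le_trans (ler_normD _ _))//.
  rewrite lerD// !normrZ !ger0_norm ?(ltW s0)//.
    by rewrite mulrCA ler_piMr ?(ltW s0)// mulr_ile1 ?norm_delta_mx.
  by rewrite mulrCA ler_piMr ?(ltW s0)// mulr_ile1 ?norm_delta_mx.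
have i0 : 0 <= (0 : R) <= 1 by rewrite lexx ler01.
have i1 : 0 <= (1 : R) <= 1 by rewrite lexx ler01.
have inb0 (x : R) : 0 <= x <= 1 -> ball u d (u + x *: a).
  by move=> x01; have := inb _ _ x01 i0; rewrite scale0r addr0.
have inb1 (x : R) : 0 <= x <= 1 -> ball u d (u + x *: a + b).
  by move=> x01; have := inb _ _ x01 i1; rewrite scale1r.
have dsh g (w : 'rV[R]_n) : differentiable g (w + b) ->
    differentiable (fun w => g (w + b)) w.
  move=> dg; apply: (@differentiable_comp _ _ _ _ (fun w => w + b) g) => //.
have Dsh g (w v : 'rV[R]_n) : 'D_v (fun w => g (w + b)) w = 'D_v g (w + b).
  rewrite /derive; congr (lim _); apply: (congr1 (fun F => F @ (0:R)^')).
  by apply/funext => h /=; rewrite addrA.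
have [t t01|t t01] := @mean_value R n (fun w => f (w + b) - f w) u a.
  apply: differentiableB; first by apply: dsh; exact: (hf _ (inb1 _ t01)).1.
  exact: (hf _ (inb0 _ t01)).1.
have [df1 _] := hf _ (inb1 _ t01); have [df0 dif0] := hf _ (inb0 _ t01).
rewrite deriveB; [|by apply: diff_derivable; exact: dsh|exact: diff_derivable].
rewrite Dsh !derive_sum_partial// => ->.
have sumE (F : 'I_n -> R) k : \sum_l (s *: delta_mx 0 k : 'rV[R]_n) 0 l *: F l = s * F k.
  rewrite (bigD1 k)//= !mxE !eqxx/= mulr1 big1 ?addr0// => l lk.
  by rewrite !mxE (negPf lk) mulr0 scale0r.
rewrite !sumE -mulrBr.
have [r r01|r r01] := @mean_value R n (partial i f) (u + t *: a) b.
  exact: (hf _ (inb _ _ t01 r01)).2.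
have [_ dif] := hf _ (inb _ _ t01 r01).
rewrite derive_sum_partial// sumE => ->.
by exists (u + t *: a + r *: b); [exact: inb | rewrite mulrA expr2].
Qed.

(** By symmetry of the second difference, the two mixed derivatives take a common value at two
    points [w1], [w2] of a ball where each stays within half of their supposed gap at [u]. The scale
    d / 3 keeps the parallelogram inside the ball of radius d. *)
Lemma partialC f (i j : 'I_n) u :
  (\near u, differentiable f u) ->
  (\near u, differentiable (partial i f) u) ->
  (\near u, differentiable (partial j f) u) ->
  {for u, continuous (partial i (partial j f))} ->
  {for u, continuous (partial j (partial i f))} ->
  partial i (partial j f) u = partial j (partial i f) u.
Proof.
move=> nf ni nj cij cji; apply/eqP; apply: contraT => neq.
set e := `|partial i (partial j f) u - partial j (partial i f) u| / 2.
have e0 : 0 < e by rewrite divr_gt0// normr_gt0 subr_eq0.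
move/cvgrPdist_lt: cij => /(_ _ e0) cij.
move/cvgrPdist_lt: cji => /(_ _ e0) cji.
have : \forall w \near u, [/\ differentiable f w, differentiable (partial i f) w,
    differentiable (partial j f) w,
    `|partial i (partial j f) u - partial i (partial j f) w| < e &
    `|partial j (partial i f) u - partial j (partial i f) w| < e].
  apply: (@filterS _ (nbhs u) _ _ _ _
    (filterI nf (filterI ni (filterI nj (filterI cij cji))))).
  by move=> w [a1 [a2 [a3 [a4 a5]]]]; apply: And5 a1 a2 a3 a4 a5.
move=> /nbhs_ballP[d/= d0 hd].
have d30 : 0 < d / 3 by rewrite divr_gt0.
have d3 : 2 * (d / 3) < d by rewrite mulrA ltr_pdivrMr// mulrC ltr_pM2l// ltr_nat.
have [|w1 /hd[_ _ _ _ h1] E1] := @second_difference f i j u _ _ d30 d3.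
  by move=> w /hd[a1 a2 _ _ _]; exact: (conj a1 a2).
have [|w2 /hd[_ _ _ h2 _] E2] := @second_difference f j i u _ _ d30 d3.
  by move=> w /hd[a1 _ a3 _ _]; exact: (conj a1 a3).
have E : partial j (partial i f) w1 = partial i (partial j f) w2.
  have d2 : (d / 3) ^+ 2 != 0 by rewrite expf_neq0// gt_eqF.
  move: E1 E2; rewrite (addrAC u (_ *: delta_mx 0 j)).
  move: (f (u + _ + _)) (f (u + _ *: delta_mx 0 i)) (f (u + _ *: delta_mx 0 j)).
  move: (f u) (partial j (partial i f) w1) (partial i (partial j f) w2).
  move=> p x y q r s e1 e2; apply: (mulfI d2); rewrite -e1 -e2; ring.
move: h1 h2; rewrite E /e.
move: (partial j (partial i f) u) (partial i (partial j f) u) (partial i _ _).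
move=> x y z h1 h2; have := ltrD h2 h1; rewrite -splitr ltNge.
by rewrite (distrC x z) ler_distD.
Qed.

End Schwarz.

(** * The ambient form and frames adapted to a hypersurface *)

Lemma row_free_ker (F : fieldType) m n (A : 'M[F]_(m, n)) :
  (forall a : 'rV_m, a *m A = 0 -> a = 0) -> row_free A.
Proof.
move=> Aker; rewrite -kermx_eq0; apply/eqP/row_matrixP => i.
by rewrite row0; apply: Aker; rewrite -row_mul mulmx_ker row0.
Qed.

Section Inner.
Context (R : realType) (n : nat) (c : R).
Implicit Types (x y z v : 'rV[R]_n.+2).

Definition form_mx : 'M[R]_n.+2 :=
  diag_mx (\row_j if j == 0 then (if c < 0 then -1 else 1) else 1).

Lemma inner_mx x y : inner c x y = (x *m form_mx *m y^T) 0 0.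
Proof.
rewrite /inner [RHS]mxE [RHS]big_ord_recl; congr (_ + _).
  by rewrite mul_mx_diag !mxE eqxx mulrA; congr (_ * _); exact: mulrC.
by apply: eq_bigr => j _; rewrite mul_mx_diag !mxE mulr1.
Qed.

Lemma trmx_form : form_mx^T = form_mx.
Proof. exact: tr_diag_mx. Qed.

Lemma innerC x y : inner c x y = inner c y x.
Proof.
by rewrite !inner_mx -[LHS]trace_mx11 -mxtrace_tr !trmx_mul trmxK trmx_form
  mulmxA trace_mx11.
Qed.

Lemma innerDl x y z : inner c (x + y) z = inner c x z + inner c y z.
Proof. by rewrite !inner_mx !mulmxDl mxE. Qed.

Lemma innerZl a x y : inner c (a *: x) y = a * inner c x y.
Proof. by rewrite !inner_mx -!scalemxAl mxE. Qed.

Lemma inner0l y : inner c 0 y = 0.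
Proof. by rewrite inner_mx !mul0mx mxE. Qed.

Lemma innerNl x y : inner c (- x) y = - inner c x y.
Proof. by rewrite -scaleN1r innerZl mulN1r. Qed.

Lemma innerDr x y z : inner c x (y + z) = inner c x y + inner c x z.
Proof. by rewrite innerC innerDl 2!(innerC x). Qed.

Lemma innerZr a x y : inner c x (a *: y) = a * inner c x y.
Proof. by rewrite innerC innerZl (innerC x). Qed.

Lemma innerNr x y : inner c x (- y) = - inner c x y.
Proof. by rewrite innerC innerNl (innerC x). Qed.

Lemma inner0r x : inner c x 0 = 0.
Proof. by rewrite innerC inner0l. Qed.

Lemma inner_suml I (r : seq I) (P : pred I) (F : I -> 'rV[R]_n.+2) y :
  inner c (\sum_(i <- r | P i) F i) y = \sum_(i <- r | P i) inner c (F i) y.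
Proof.
exact: (big_morph (fun x => inner c x y) (fun _ _ => innerDl _ _ _) (inner0l _)).
Qed.

Lemma inner_sumr I (r : seq I) (P : pred I) (F : I -> 'rV[R]_n.+2) y :
  inner c y (\sum_(i <- r | P i) F i) = \sum_(i <- r | P i) inner c y (F i).
Proof. by rewrite innerC inner_suml; apply: eq_bigr => i _; rewrite innerC. Qed.

Definition innerE := (innerDl, innerDr, innerZl, innerZr, innerNl, innerNr).

(** Only c < 0 is not immediate. If <v, v> <= 0, write v_0 = t x_0: the last n + 1 coordinates of v
    - t x have a sum of squares at most t^2 / c <= 0, so t = 0 and then v = 0. *)
Lemma tangent_gt0 x v :
  space_form c x -> tangent c x v -> v != 0 -> 0 < inner c v v.
Proof.
move=> Mx Tv v0.
have coord0 : v 0 0 = 0 -> (forall j : 'I_n.+1, v 0 (lift ord0 j) = 0) -> v = 0.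
  move=> v00 vj; apply/rowP => i; rewrite [RHS]mxE.
  by case: (unliftP ord0 i) => [j ->|->].
have sq0 (F : 'I_n.+1 -> R) : \sum_j F j ^+ 2 <= 0 -> forall j, F j = 0.
  move=> F0 j; apply/eqP; rewrite -sqrf_eq0; apply/eqP.
  have /eqP : \sum_j F j ^+ 2 == 0 by rewrite eq_le F0/= sumr_ge0// => k _; rewrite sqr_ge0.
  by move/psumr_eq0P => -> // k _; exact: sqr_ge0.
rewrite ltNge; apply: contra v0 => vv0; apply/eqP.
have [c0|c0] := ltP c 0; last first.
  have vv : v 0 0 ^+ 2 + \sum_j v 0 (lift ord0 j) ^+ 2 <= 0.
    move: vv0; rewrite /inner ltNge c0/= mul1r.
    by under eq_bigr do rewrite -expr2; rewrite -expr2.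
  apply: coord0.
    apply/eqP; rewrite -sqrf_eq0 eq_le sqr_ge0 andbT; apply: le_trans vv.
    by rewrite lerDl sumr_ge0// => k _; rewrite sqr_ge0.
  by apply: sq0; apply: le_trans vv; rewrite lerDr sqr_ge0.
move: Mx Tv; rewrite /space_form /tangent /= lt_eqF// => -[xx /(_ c0) x0].
move: vv0 xx; rewrite /inner c0.
set Svv := \sum_j v _ _ * _; set Sxx := \sum_j x _ _ * x _ _.
set Svx := \sum_j v _ _ * x _ _ => vv xx vx.
have k0 : c^-1 < 0 by rewrite invr_lt0.
pose t := v 0 0 / x 0 0.
have xt : v 0 0 = t * x 0 0 by rewrite divfK// gt_eqF.
have S0 : \sum_j (v 0 (lift ord0 j) - t * x 0 (lift ord0 j)) ^+ 2
    = Svv - 2 * t * Svx + t ^+ 2 * Sxx.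
  rewrite /Svv /Svx /Sxx !mulr_sumr -sumrB -big_split/=.
  by apply: eq_bigr => j _; ring.
have S1 : \sum_j (v 0 (lift ord0 j) - t * x 0 (lift ord0 j)) ^+ 2
    <= t ^+ 2 * c^-1.
  rewrite S0; move: vv vx xx; rewrite xt; nra.
have tk : t ^+ 2 * c^-1 <= 0 by rewrite mulr_ge0_le0 ?sqr_ge0// ltW.
have t0 : t = 0.
  have : 0 <= t ^+ 2 * c^-1 by apply: le_trans S1; rewrite sumr_ge0// => k _; exact: sqr_ge0.
  by rewrite nmulr_lge0// => t2; apply/eqP; rewrite -sqrf_eq0 eq_le t2 sqr_ge0.
apply: coord0; first by rewrite xt t0 mul0r.
by move=> j; have := sq0 _ (le_trans S1 tk) j; rewrite t0 mul0r subr0.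
Qed.

(* Equality in Cauchy-Schwarz would force both norms to vanish, so two timelike
   vectors of the same length lie on the same sheet iff their product is negative. *)
Lemma hyperboloid_sheet x y : c < 0 -> space_form c x -> inner c y y = c^-1 ->
  (0 < y 0 0) = (inner c x y < 0).
Proof.
move=> c0; rewrite /space_form /= lt_eqF// => -[+ /(_ c0) x0].
have k0 : c^-1 < 0 by rewrite invr_lt0.
rewrite /inner c0; set Syy := \sum_j y _ _ * y _ _; set Sxx := \sum_j x _ _ * x _ _.
set Sxy := \sum_j x _ _ * y _ _ => xx yy.
have S (e : R) : 0 <= y 0 0 ^+ 2 * Sxx + e * (2 * x 0 0 * y 0 0 * Sxy)
     + e ^+ 2 * (x 0 0 ^+ 2 * Syy).
  have -> : y 0 0 ^+ 2 * Sxx + e * (2 * x 0 0 * y 0 0 * Sxy)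
      + e ^+ 2 * (x 0 0 ^+ 2 * Syy) =
    \sum_j (y 0 0 * x 0 (lift ord0 j) + e * x 0 0 * y 0 (lift ord0 j)) ^+ 2.
    rewrite /Sxx /Sxy /Syy !mulr_sumr -!big_split/=.
    by apply: eq_bigr => j _; ring.
  by apply: sumr_ge0 => j _; exact: sqr_ge0.
have Sp := S 1; have Sm := S (-1).
have {}xx : Sxx = x 0 0 ^+ 2 + c^-1 by move: xx; rewrite mulN1r => <-; ring.
have {}yy : Syy = y 0 0 ^+ 2 + c^-1 by move: yy; rewrite mulN1r => <-; ring.
have x2 : 0 < x 0 0 ^+ 2 by rewrite exprn_gt0.
have neg : (x 0 0 ^+ 2 + y 0 0 ^+ 2) * c^-1 < 0.
  by rewrite pmulr_rlt0// ltr_wpDr// sqr_ge0.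
move: Sp Sm neg; rewrite xx yy; move: (x 0 0) (y 0 0) c^-1 Sxy x0 {x2 xx yy k0 S}.
move=> a b k S a0 Sp Sm neg; apply/idP/idP => h; rewrite ltNge; apply/negP => h'.
  have ab : 0 < a * b by rewrite mulr_gt0.
  have : (a * b) * (a * b) <= (a * b) * S by rewrite ler_pM2l//; lra.
  move: Sm neg; nra.
have ab : a * b <= 0 by rewrite mulr_ge0_le0// ltW.
have : (a * b) * (a * b) <= (a * b) * S by rewrite ler_wnM2l//; lra.
move: Sm neg; nra.
Qed.

Lemma inner_row k (A : 'M[R]_(k, n.+2)) v i :
  inner c v (row i A) = (v *m form_mx *m A^T) 0 i.
Proof. by rewrite inner_mx tr_row colE mulmxA -colE mxE. Qed.

Lemma tangent0 x : tangent c x 0.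
Proof. by rewrite /tangent; case: ifP => _; rewrite ?mxE ?inner0l. Qed.

Lemma tangentZ a x v : tangent c x v -> tangent c x (a *: v).
Proof. by rewrite /tangent; case: ifP => _; rewrite ?mxE ?innerZl => ->; rewrite mulr0. Qed.

Lemma tangentD x v w : tangent c x v -> tangent c x w -> tangent c x (v + w).
Proof.
by rewrite /tangent; case: ifP => _; rewrite ?mxE ?innerDl => -> ->; rewrite addr0.
Qed.

(** Tangency, the kernel of [tau], and orthogonality are k + 1 linear equations in n + 2 unknowns. A
    nonzero solution has positive square by [tangent_gt0] and can be normalized. *)
Lemma exists_unit_normal k (A : 'M[R]_(k, n.+2)) x :
  space_form c x -> (k <= n)%N ->
  exists N, [/\ tangent c x N, inner c N N = 1 &
                forall i, inner c N (row i A) = 0].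
Proof.
move=> Mx kn; pose tau : 'cV[R]_n.+2 :=
  if c == 0 then delta_mx 0 0 else form_mx *m x^T.
have tauE v : v *m tau = 0 -> tangent c x v.
  move=> /matrixP/(_ 0 0); rewrite /tangent /tau; case: ifP => _.
    by rewrite -colE !mxE.
  by rewrite mulmxA -inner_mx mxE.
pose B := row_mx (form_mx *m A^T) tau.
have : kermx B != 0.
  rewrite -mxrank_eq0 mxrank_ker subn_eq0 -ltnNge.
  by apply: leq_ltn_trans (rank_leq_col _) _; rewrite addn1 !ltnS.
rewrite -nz_row_eq0; set v := nz_row _ => v0.
have : v *m B = 0 by apply/sub_kermxP; exact: nz_row_sub.
rewrite mul_mx_row -row_mx0 => /eq_row_mx[vA /tauE vt].
have vv := tangent_gt0 Mx vt v0; pose a := (Num.sqrt (inner c v v))^-1.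
have a2 : a ^+ 2 * inner c v v = 1.
  by rewrite exprVn sqr_sqrtr ?mulVf ?gt_eqF// ltW.
exists (a *: v); split.
- exact: tangentZ.
- by rewrite !innerE mulrA -expr2.
- by move=> i; rewrite innerZl inner_row -mulmxA vA mxE mulr0.
Qed.

(** Rows are added one at a time as unit normals to [v] and the rows already found; counting [v],
    these are at most n conditions, the bound of [exists_unit_normal]. *)
Lemma exists_orthonormal x v : space_form c x ->
  exists E : 'M[R]_(n, n.+2),
    [/\ forall b, tangent c x (row b E), forall b, inner c (row b E) v = 0 &
        forall a b, inner c (row a E) (row b E) = (a == b)%:R].
Proof.
move=> Mx.
pose P k := exists E : 'M[R]_(k, n.+2),
    [/\ forall b, tangent c x (row b E), forall b, inner c (row b E) v = 0 &
        forall a b, inner c (row a E) (row b E) = (a == b)%:R].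
suff H k : (k <= n)%N -> P k by exact: H.
elim: k => [_|k IH kn]; first by exists 0; split => -[].
have [E [ET Ev EE]] := IH (ltnW kn).
have [N [NT NN NE]] := @exists_unit_normal _ (col_mx v E) x Mx kn.
have Nv : inner c N v = 0 by have := NE (lshift _ 0); rewrite rowKu row_id.
have {}NE b : inner c N (row b E) = 0 by have := NE (rshift _ b); rewrite rowKd.
change (P (1 + k)%N).
exists (col_mx N E); split=> [b|b|a b].
- by case: (split_ordP b) => j ->; rewrite ?rowKu ?rowKd ?row_id.
- by case: (split_ordP b) => j ->; rewrite ?rowKu ?rowKd ?row_id.
- case: (split_ordP a) => i ->; case: (split_ordP b) => j ->;
    rewrite ?rowKu ?rowKd ?row_id ?eq_lshift ?eq_rshift ?eq_lrshift ?eq_rlshift //.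
    by rewrite NN !ord1 eqxx.
  by rewrite innerC NE.
Qed.

Section Frame.
Context (x N : 'rV[R]_n.+2) (V : 'M[R]_(n, n.+2)).
Hypotheses (Mx : space_form c x) (Vfree : row_free V).
Hypotheses (VT : forall i, tangent c x (row i V)) (NT : tangent c x N).
Hypotheses (NN : inner c N N = 1) (NV : forall i, inner c N (row i V) = 0).

Lemma mulmx_tangent k (a : 'rV[R]_k) (A : 'M[R]_(k, n.+2)) :
  (forall i, tangent c x (row i A)) -> tangent c x (a *m A).
Proof.
move=> AT; rewrite mulmx_sum_row; elim/big_ind: _ => //.
- exact: tangent0.
- by move=> *; exact: tangentD.
- by move=> *; exact: tangentZ.
Qed.

Lemma tangent_eq0 v : tangent c x v -> inner c v v = 0 -> v = 0.
Proof.
move=> vT vv; apply/eqP; apply: contraT => /(tangent_gt0 Mx vT).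
by rewrite vv ltxx.
Qed.

Definition gram : 'M[R]_n := V *m form_mx *m V^T.

Lemma gramE i j : gram i j = inner c (row i V) (row j V).
Proof. by rewrite inner_row -mulmxA -row_mul mulmxA [RHS]mxE. Qed.

Lemma trmx_gram : gram^T = gram.
Proof. by rewrite /gram !trmx_mul trmxK trmx_form mulmxA. Qed.

Lemma gram_unit : gram \in unitmx.
Proof.
rewrite -row_free_unit; apply: row_free_ker => a aG.
have aV : a *m V = 0.
  apply: tangent_eq0; first exact: mulmx_tangent.
  by rewrite inner_mx trmx_mul !mulmxA -2!(mulmxA a) aG mul0mx mxE.
by apply: (row_free_inj Vfree); rewrite aV mul0mx.
Qed.

Definition covector v : 'rV[R]_n := v *m form_mx *m V^T.

Lemma covectorE v i : covector v 0 i = inner c v (row i V).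
Proof. by rewrite inner_row. Qed.

(** The factor c treats the three models at once: for c = 0 a point need not be orthogonal to its
    tangent vectors, but the term is then multiplied by 0. *)
Lemma c_inner_tangent v : tangent c x v -> c * inner c v x = 0.
Proof. by rewrite /tangent; case: eqP => [-> _|_ ->]; rewrite ?mul0r ?mulr0. Qed.

Lemma inner_mulmx v (a : 'rV[R]_n) :
  inner c v (a *m V) = (covector v *m a^T) 0 0.
Proof. by rewrite inner_mx trmx_mul !mulmxA. Qed.

Lemma tangent_scale_eq0 a : tangent c x (a *: x) -> a = 0.
Proof.
move: Mx; rewrite /space_form /tangent /=; case: eqP => [_ x0|/eqP c0 [xx _]].
  by rewrite mxE x0 mulr1.
by rewrite innerZl xx => /eqP; rewrite mulf_eq0 invr_eq0 (negPf c0) orbF => /eqP.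
Qed.

Lemma frame_row_free : row_free (col_mx x (col_mx N V)).
Proof.
apply: row_free_ker => a; rewrite -[a]hsubmxK -[rsubmx a]hsubmxK.
move: (lsubmx a) (lsubmx (rsubmx a)) (rsubmx (rsubmx a)) => p q r.
rewrite !mul_row_col [p]mx11_scalar [q]mx11_scalar !mul_scalar_mx.
move: (p 0 0) (q 0 0) => {}p {}q pqr.
have p0 : p = 0.
  apply: tangent_scale_eq0; rewrite -[_ *: x]opprK -scaleN1r; apply: tangentZ.
  have -> : - (p *: x) = q *: N + r *m V.
    by apply/eqP; rewrite eq_sym -subr_eq0 opprK addrC pqr.
  by apply: tangentD; [exact: tangentZ | exact: mulmx_tangent].
move: pqr; rewrite p0 scale0r add0r => qr.
have q0 : q = 0.
  have := congr1 (inner c N) qr.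
  rewrite innerDr innerZr NN mulr1 inner0r inner_mulmx.
  rewrite (_ : covector N = 0) ?mul0mx ?mxE ?addr0//.
  by apply/rowP => i; rewrite covectorE NV mxE.
move: qr; rewrite q0 scale0r add0r => rV.
rewrite (_ : r = 0) ?scalar_mx0_subproof.
  by rewrite !(raddf0, row_mx0).
by apply: (row_free_inj Vfree); rewrite rV mul0mx.
Qed.

(** The coefficient of x comes from <x, x> = 1/c; for c = 0 that term drops out and v_0 = 0 takes
    its place. The difference [D] of the two sides is tangent and orthogonal to [N] and [V]. As x, N
    and the rows of V form a basis, D is a combination of N and V alone, so <D, D> = 0. *)
Lemma frame_decomposition v : (c = 0 -> v 0 0 = 0) ->
  v = covector v *m invmx gram *m V + inner c v N *: N + (c * inner c v x) *: x.
Proof.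
move=> v0; set w := RHS; apply/eqP; rewrite -subr_eq0; apply/eqP.
set D := v - w.
have aT (a : 'rV_n) : tangent c x (a *m V) by exact: mulmx_tangent.
have Vc i : c * inner c x (row i V) = 0 by rewrite innerC c_inner_tangent.
have DT : tangent c x D.
  rewrite /D /w /tangent; move: Mx; rewrite /space_form /=.
  have := aT (covector v *m invmx gram); have := NT; rewrite /tangent.
  case: eqP => [c0 N0 a0 x0|/eqP c0 N0 a0 [xx _]].
    have E (A : 'rV[R]_n.+2) q : (v - (A + q *: N)) 0 0 = v 0 0 - (A 0 0 + q * N 0 0).
      by rewrite !mxE.
    have -> : (c * inner c v x) *: x = 0 by rewrite c0 mul0r scale0r.
    by rewrite addr0 E v0// a0 N0 mulr0 !(addr0, oppr0).
  by rewrite !innerE a0 N0 xx mulr0 !add0r mulrAC mulfV// mul1r subrr.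
have DV : covector D = 0.
  apply/rowP => i; rewrite [RHS]mxE covectorE /D /w !innerE NV mulr0 addr0.
  rewrite mulrAC Vc mul0r addr0 -covectorE (innerC _ (row i V)) inner_mulmx.
  rewrite trmx_mul trmx_inv trmx_gram.
  have -> : covector (row i V) = row i gram by rewrite /covector -!row_mul.
  by rewrite mulmxA -row_mul mulmxV ?gram_unit// row1 -rowE !mxE subrr.
have DN : inner c D N = 0.
  rewrite /D /w !innerE NN mulr1 (innerC x) mulrAC c_inner_tangent// mul0r addr0.
  rewrite (innerC (_ *m V)) inner_mulmx (_ : covector N = 0) ?mul0mx ?mxE ?add0r ?subrr//.
  by apply/rowP => i; rewrite covectorE NV mxE.
have : (D <= col_mx x (col_mx N V))%MS.
  by apply: submx_full; rewrite row_full_unit -row_free_unit frame_row_free.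
case/submxP => a; rewrite -[a]hsubmxK -[rsubmx a]hsubmxK.
move: (lsubmx a) (lsubmx (rsubmx a)) (rsubmx (rsubmx a)) => p q r.
rewrite !mul_row_col [p]mx11_scalar [q]mx11_scalar !mul_scalar_mx.
move: (p 0 0) (q 0 0) => {}p {}q Dpqr.
have p0 : p = 0.
  apply: tangent_scale_eq0.
  have -> : p *: x = D + (-1) *: (q *: N + r *m V) by rewrite Dpqr scaleN1r addrK.
  by apply: tangentD => //; apply/tangentZ/tangentD => //; exact: tangentZ.
apply: tangent_eq0 => //.
have DD : D = q *: N + r *m V by rewrite Dpqr p0 scale0r add0r.
transitivity (inner c D (q *: N + r *m V)); first by rewrite -DD.
by rewrite innerDr innerZr DN inner_mulmx DV mul0mx mxE mulr0 addr0.
Qed.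

Lemma inner_frame v w : (c = 0 -> v 0 0 = 0) ->
  inner c v w = (covector v *m invmx gram *m (covector w)^T) 0 0
    + inner c v N * inner c w N + c * inner c v x * inner c w x.
Proof.
move=> v0; rewrite {1}(frame_decomposition v0) !innerE (innerC N) (innerC x).
congr (_ + _ + _).
by rewrite innerC inner_mx /covector !trmx_mul !trmxK trmx_form !mulmxA
  -[LHS]trace_mx11 -mxtrace_tr !trmx_mul !trmxK trmx_form !mulmxA trace_mx11.
Qed.

End Frame.

End Inner.

(** * Matrix algebra of the fundamental forms at one point *)

Lemma rank_le1_factor (F : fieldType) m n (M : 'M[F]_(m, n)) :
  (\rank M <= 1)%N -> exists (C : 'cV_m) (A : 'rV_n), M = C *m A.
Proof.
have := mulmx_base M; move: (col_base M) (row_base M).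
move: (\rank M) => [|[|//]] C A <- _; last by exists C, A.
by exists 0, 0; rewrite [C]thinmx0 !mul0mx.
Qed.

(* E and d^T are columns in the kernel of Xi, so [E d^T] has rank at most one. *)
Lemma corank1_annihilated (F : fieldType) n (G E Xi : 'M[F]_n) (d : 'rV[F]_n) :
  E^T = E -> Xi *m E = 0 -> Xi *m d^T = 0 -> (n.-1 <= \rank Xi)%N ->
  E *m G *m E = \tr (G *m E) *: E /\ d *m G *m E = \tr (G *m E) *: d.
Proof.
move=> Esym XE Xd rX.
have : (\rank (row_mx E d^T) <= 1)%N.
  have : (\rank Xi + \rank (row_mx E d^T) <= n)%N.
    by apply: mulmx0_rank_max; rewrite mul_mx_row XE Xd row_mx0.
  move=> h; rewrite -(leq_add2l n.-1); apply: leq_trans (leq_trans h _).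
    by rewrite leq_add2r.
  by case: (n) => // k; rewrite addn1.
case/rank_le1_factor => C [A]; rewrite -[A]hsubmxK mul_mx_row => /eq_row_mx[].
move: (lsubmx A) (rsubmx A) => {}A b EA dT.
have dE : d = b^T *m C^T by rewrite -trmx_mul -dT trmxK.
have scal (t : 'M[F]_1) k l (B : 'M[F]_(k, 1)) (D : 'M[F]_(1, l)) :
    B *m t *m D = \tr t *: (B *m D).
  by rewrite [t in LHS]mx11_scalar mul_mx_scalar -scalemxAl trace_mx11.
split.
  rewrite {1 2}EA -!mulmxA (mulmxA A) (mulmxA (A *m G)) (mulmxA C) scal -EA.
  by rewrite EA mulmxA [in RHS]mxtrace_mulC mulmxA.
have EA' : E = A^T *m C^T by rewrite -trmx_mul -EA Esym.
rewrite {1}dE EA' !mulmxA -(mulmxA _ C^T) -(mulmxA _ _ A^T) scal -dE.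
by congr (_ *: _); rewrite -[in LHS]mulmxA [in LHS]mxtrace_mulC.
Qed.

Lemma rank_scalar_sub (F : fieldType) n (a : F) (v w : 'rV[F]_n) : a != 0 ->
  (n.-1 <= \rank (a%:M - v^T *m w : 'M[F]_n)%R)%N.
Proof.
move=> a0; have ra : \rank (a%:M : 'M[F]_n) = n.
  by apply: mxrank_unit; rewrite unitmxE det_scalar unitfE expf_neq0.
have : (\rank (a%:M : 'M[F]_n) <= \rank (a%:M - v^T *m w : 'M[F]_n)%R + 1)%N.
  rewrite -{1}[a%:M](subrK (v^T *m w)); apply: leq_trans (mxrank_add _ _) _.
  by rewrite leq_add2l; apply: leq_trans (mxrankM_maxr _ _) (rank_leq_row _).
by rewrite ra -subn1 leq_subLR addnC.
Qed.

(* g and H are the two fundamental forms, P the projections of the frame to the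
   coordinates z orthogonal to the axis, and w the projection of the normal. *)
Section RotationalAlgebra.
Context (F : fieldType) (n : nat) (c : F) (g H P : 'M[F]_n) (z w : 'rV[F]_n).
Let rho := (z *m z^T) 0 0.
Let nu := (z *m w^T) 0 0.
(** Half the differential of rho, the rows of [P] being the derivatives of z. *)
Let d := z *m P^T.
Hypotheses (gsym : g^T = g) (gunit : g \in unitmx) (Hsym : H^T = H).
Hypothesis PgP : P^T *m invmx g *m P = 1%:M - w^T *m w - c *: (z^T *m z).
Hypothesis zw : rho *: w = nu *: z.

Let zz : z *m z^T = rho%:M. Proof. exact: mx11_scalar. Qed.
Let zwT : z *m w^T = nu%:M. Proof. exact: mx11_scalar. Qed.
Let wzT : w *m z^T = nu%:M.
Proof. by rewrite -[LHS]trmxK trmx_mul trmxK zwT tr_scalar_mx. Qed.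

Lemma rot_dgP : d *m invmx g *m P = z - nu *: w - (c * rho) *: z.
Proof.
rewrite /d -!mulmxA (mulmxA P^T) PgP !mulmxBr mulmx1 mulmxA zwT mul_scalar_mx.
by rewrite -scalemxAr mulmxA zz mul_scalar_mx scalerA.
Qed.

(** In the application the left side is |grad rho|^2 / 4. *)
Lemma rot_dgd : (d *m invmx g *m d^T) 0 0 = rho - nu ^+ 2 - c * rho ^+ 2.
Proof.
rewrite {2}/d trmx_mul trmxK mulmxA rot_dgP !mulmxBl -!scalemxAl zz wzT.
rewrite !mxE !eqxx !mulr1n; ring.
Qed.

Lemma rot_trace : \tr (P^T *m invmx g *m P) = n%:R - (w *m w^T) 0 0 - c * rho.
Proof.
by rewrite PgP !raddfB/= mxtrace1 linearZ/= (mxtrace_mulC w^T) (mxtrace_mulC z^T) !trace_mx11.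
Qed.

Lemma rot_ww : rho * (w *m w^T) 0 0 = nu ^+ 2.
Proof.
have : (rho *: w *m w^T) 0 0 = (nu *: z *m w^T) 0 0 by rewrite zw.
by rewrite -!scalemxAl zwT !mxE eqxx mulr1n expr2.
Qed.

Lemma rot_dgPP :
  rho *: (d *m invmx g *m P *m P^T) = (rho - nu ^+ 2 - c * rho ^+ 2) *: d.
Proof.
have wP : rho *: (w *m P^T) = nu *: d by rewrite scalemxAl zw -scalemxAl.
rewrite rot_dgP !mulmxBl -!scalemxAl -/d !scalerBr !scalerA (mulrC rho nu).
rewrite -(scalerA nu) wP scalerA -!scalerBl; congr (_ *: _); ring.
Qed.

Hypotheses (rho0 : rho != 0) (Htr : \tr (invmx g *m H) = 0).
(** The rows of rho P^T - z^T d, raised by the inverse metric, are tangent to the orbits of the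
    rotations. As rho w = nu z, the right side is -nu / rho times the same matrix: orbit directions
    are principal with curvature -nu / rho. *)
Hypothesis eigen :
  (rho *: P^T - z^T *m d) *m invmx g *m H = w^T *m d - nu *: P^T.

Let lam := nu / rho.
Let D := H + lam *: g.
Let Xi := (rho *: P^T - z^T *m d) *m invmx g.

Let nulam : nu = lam * rho. Proof. by rewrite divfK. Qed.

Let wlam : w = lam *: z.
Proof.
apply: (scalerI rho0); rewrite zw scalerA; congr (_ *: _).
by rewrite nulam mulrC.
Qed.

Let wT : w^T = lam *: z^T. Proof. by rewrite {1}wlam linearZ. Qed.

(** [Xi] kills [D] by [eigen] and kills d^T because orbits are orthogonal to grad rho. Its rank is
    at least n - 1 since Xi P is rho minus the matrix z^T z of rank at most one. *)
Lemma rot_rank : D *m invmx g *m D = \tr (invmx g *m D) *: D /\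
  d *m invmx g *m D = \tr (invmx g *m D) *: d.
Proof.
apply: (@corank1_annihilated _ _ _ _ Xi).
- by rewrite /D linearD linearZ/= Hsym gsym.
- rewrite /D mulmxDr eigen -scalemxAr /Xi -mulmxA mulVmx// mulmx1.
  by rewrite wT -scalemxAl scalerBr scalerA -nulam addrC addrA subrK subrr.
- rewrite /Xi !mulmxBl -!scalemxAl.
  have -> : P^T *m invmx g *m d^T = (d *m invmx g *m P)^T.
    by rewrite !trmx_mul trmx_inv gsym !mulmxA.
  have -> : z^T *m d *m invmx g *m d^T = (rho - nu ^+ 2 - c * rho ^+ 2) *: z^T.
    rewrite -2!(mulmxA z^T) [d *m _ *m _]mx11_scalar rot_dgd mul_mx_scalar //.
  rewrite rot_dgP.
  rewrite !linearB/= !linearZ/= wT !scalerA.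
  by apply/matrixP => i j; rewrite !mxE nulam; ring.
- have : (n.-1 <= \rank (Xi *m P))%N.
    have -> : Xi *m P = rho%:M - z^T *m z.
      rewrite /Xi !mulmxBl -!scalemxAl PgP -2!(mulmxA z^T) rot_dgP.
      rewrite !mulmxBr -!scalemxAr !scalerBr scalemx1 wT -scalemxAl.
      rewrite wlam -!scalemxAr !scalerA; move: (z^T *m z) => Z.
      by rewrite nulam; apply/matrixP => i j; rewrite !mxE; ring.
    exact: rank_scalar_sub.
  by move=> h; apply: leq_trans h (mxrankM_maxl _ _).
Qed.

Let trD : \tr (invmx g *m D) = lam * n%:R.
Proof. by rewrite /D mulmxDr -scalemxAr mulVmx// !raddfD/= Htr add0r linearZ/= mxtrace1. Qed.

(** With K = g^-1 D, [rot_rank] gives K^2 = n lam K, and tr K = n lam by minimality; hence tr (K -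
    lam)^2 = n (n - 1) lam^2. *)
Lemma rot_normA :
  rho ^+ 2 * \tr (invmx g *m H *m invmx g *m H^T) = n%:R * (n%:R - 1) * nu ^+ 2.
Proof.
have [DD _] := rot_rank; rewrite trD in DD.
have HD : H = D - lam *: g by rewrite /D addrK.
have gH : invmx g *m H = invmx g *m D - lam%:M.
  by rewrite HD mulmxBr -scalemxAr mulVmx// scalemx1.
have KK : (invmx g *m D) *m (invmx g *m D) = (lam * n%:R) *: (invmx g *m D).
  by rewrite -mulmxA (mulmxA D) DD -scalemxAr.
rewrite Hsym -mulmxA gH mulmxBl !mulmxBr KK mul_mx_scalar mul_scalar_mx.
rewrite -scalar_mxM !raddfB/= !linearZ/= trD mxtrace_scalar nulam -mulr_natr; ring.
Qed.

Lemma rot_dgH : rho *: (d *m invmx g *m H) = ((n%:R - 1) * nu) *: d.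
Proof.
have [_ dD] := rot_rank; rewrite trD in dD.
rewrite (_ : H = D - lam *: g); last by rewrite /D addrK.
rewrite mulmxBr dD -scalemxAr -mulmxA mulVmx// mulmx1 -scalerBl scalerA nulam.
congr (_ *: _); ring.
Qed.

End RotationalAlgebra.

Lemma mulmx_row_col (F : fieldType) m n p (A : 'M[F]_(m, n)) (B : 'M[F]_(n, p)) i j :
  (row i A *m col j B) 0 0 = (A *m B) i j.
Proof. by rewrite colE mulmxA -row_mul -colE !mxE. Qed.

(* The last three terms of the Gram matrix of an orthonormal family E of the
   ambient tangent space at the axis, split along the hypersurface. *)
Lemma basis_gram (R : realType) (n : nat) (c : R) (x N : 'rV[R]_n.+2)
    (V E : 'M[R]_(n, n.+2)) (z : 'rV[R]_n) :
  space_form c x -> row_free V -> (forall i, tangent c x (row i V)) ->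
  tangent c x N -> inner c N N = 1 -> (forall i, inner c N (row i V) = 0) ->
  (forall b, c = 0 -> E b 0 = 0) ->
  (forall a b, inner c (row a E) (row b E) = (a == b)%:R) ->
  (forall b, c * inner c (row b E) x = c * z 0 b) ->
  let P := V *m form_mx n c *m E^T in
  let w := \row_b inner c N (row b E) in
  P^T *m invmx (gram c V) *m P = 1%:M - w^T *m w - c *: (z^T *m z).
Proof.
move=> Mx Vfree VT NT NN NV E0 EE cz P w.
have covE b : covector c V (row b E) = row b P^T.
  apply/rowP => i; rewrite covectorE innerC inner_row -mulmxA -row_mul mulmxA.
  by rewrite /P !mxE.
apply/matrixP => a b; have v0 : c = 0 -> row a E 0 0 = 0 by rewrite mxE; exact: E0.
have := inner_frame Mx Vfree VT NT NN NV (row b E) v0.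
rewrite EE !covE mulrAC cz mulrAC cz tr_row trmxK.
rewrite -(row_mul a) mulmx_row_col => ab.
rewrite !mxE ab !big_ord1 !mxE (innerC _ N) (innerC _ N (row b E)); ring.
Qed.

(** * Immersed sheets and countable covers by thin sets *)

Section Smooth.
Context (R : realType) (n : nat) (V : normedModType R).
Implicit Types (U : set 'rV[R]_n) (f : 'rV[R]_n -> V).

Lemma smooth_differentiable U f u : smooth_on U f -> U u -> differentiable f u.
Proof. by move=> sf; exact: (sf 1%N [::]). Qed.

Lemma smooth_partial U f i : smooth_on U f -> smooth_on U (partial i f).
Proof.
move=> sf k s sk u Uu; have := sf k.+1 (rcons s i); rewrite size_rcons.
by move=> /(_ sk u Uu); rewrite /iter_partial foldr_rcons.
Qed.

End Smooth.

Section Immersion.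
Context (R : realType) (n m : nat).
Implicit Types (X : 'rV[R]_n -> 'rV[R]_m) (u v : 'rV[R]_n).

Lemma normr_rowE k (v : 'rV[R]_k) (e : R) : 0 <= e ->
  (`|v| <= e) = [forall i, `|v 0 i| <= e].
Proof.
move=> e0; apply/idP/forallP => [ve i|ve].
  apply: le_trans ve; rewrite [leRHS]/Num.Def.normr/= mx_normrE.
  exact: (le_bigmax _ (fun ij : 'I_1 * 'I_k => `|v ij.1 ij.2|) (0, i)).
rewrite /Num.Def.normr/= mx_normrE; apply: bigmax_le => //= -[i j] _.
by rewrite ord1.
Qed.

Lemma normr_coord k (v : 'rV[R]_k) i : `|v 0 i| <= `|v|.
Proof. by move: i; apply/forallP; rewrite -normr_rowE. Qed.

Lemma mulmx_lipschitz k l (B : 'M[R]_(k, l)) :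
  exists2 K, 0 <= K & forall y : 'rV[R]_k, `|y *m B| <= K * `|y|.
Proof.
exists (\sum_i \sum_j `|B i j|); first by do 2 apply: sumr_ge0 => *.
move=> y; rewrite normr_rowE; last first.
  by rewrite mulr_ge0//; do 2 apply: sumr_ge0 => *.
apply/forallP => j; rewrite mxE; apply: le_trans (ler_norm_sum _ _ _) _.
rewrite mulr_suml; apply: ler_sum => i _; rewrite normrM mulrC.
apply: ler_pM => //; last exact: normr_coord.
by rewrite (bigD1 j)//= lerDl sumr_ge0.
Qed.

Lemma ball_segment k (v u u' : 'rV[R]_k) r t : 0 <= t <= 1 ->
  ball v r u -> ball v r u' -> ball v r (u' + t *: (u - u')).
Proof.
move=> /andP[t0 t1]; rewrite -!ball_normE /ball_/= => vu vu'.
have -> : v - (u' + t *: (u - u')) = t *: (v - u) + (1 - t) *: (v - u').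
  by apply/rowP => i; rewrite !mxE; ring.
apply: le_lt_trans (ler_normD _ _) _; rewrite !normrZ ger0_norm// ger0_norm ?subr_ge0//.
have [->|tn] := eqVneq t 0; first by rewrite mul0r add0r subr0 mul1r.
have tp : 0 < t by rewrite lt_neqAle eq_sym tn.
have : t * `|v - u| < t * r by rewrite ltr_pM2l.
have : (1 - t) * `|v - u'| <= (1 - t) * r by rewrite ler_wpM2l ?subr_ge0// ltW.
lra.
Qed.

Lemma small_partial_lipschitz (G : 'rV[R]_n -> R) v (r e : R) : 0 <= e ->
  (forall u, ball v r u -> differentiable G u) ->
  (forall u i, ball v r u -> `|partial i G u| <= e) ->
  forall u u', ball v r u -> ball v r u' -> `|G u - G u'| <= n%:R * e * `|u - u'|.
Proof.
move=> e0 dG sG u u' ru ru'.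
have [t t01|t t01] := @mean_value R n G u' (u - u').
  by apply: dG; exact: ball_segment.
have bt := ball_segment t01 ru ru'.
rewrite subrKC derive_sum_partial; last exact: dG.
move=> ->; apply: le_trans (ler_norm_sum _ _ _) _.
rewrite -[n in n%:R]card_ord mulrAC -mulrA mulr_natl -sumr_const; apply: ler_sum => i _.
by rewrite normrM; apply: ler_pM => //; [exact: normr_coord | exact: sG].
Qed.

Lemma has_gradient_mulmx p X (B : 'M[R]_(m, p)) j u : differentiable X u ->
  has_gradient (fun w => (X w *m B) 0 j) u (fun i => (partial i X u *m B) 0 j).
Proof.
move=> dX; have := has_gradient_sum (index_enum _) (fun k =>
  has_gradientM (has_gradient_coord k dX) (has_gradient_cst (B k j) u)).
rewrite (_ : (fun w => _) = (fun w => (X w *m B) 0 j)); last first.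
  by apply/funext => w; rewrite mxE.
move=> h; apply: has_gradient_eq h _ => i /=; rewrite mxE.
by apply: eq_bigr => k _; rewrite mulr0 addr0.
Qed.

(** For a right inverse [B] of the Jacobian at [v], the map X B - id has zero derivative at [v], so
    near [v] it is Lipschitz with constant 1/2, and u - u' is controlled by X u B - X u' B. *)
Lemma immersion_lipschitz X (U : set 'rV[R]_n) v :
  open U -> U v -> smooth_on U X -> row_free (\matrix_(i < n) partial i X v) ->
  exists r C : R, [/\ 0 < r, 0 <= C & forall u u', ball v r u -> ball v r u' ->
    `|u - u'| <= C * `|X u - X u'|].
Proof.
move=> oU Uv sX /row_freeP[B JB].
pose G j u := (X u *m B) 0 j - u 0 j.
have Ggrad j u : U u ->
    has_gradient (G j) u (fun i => (partial i X u *m B) 0 j - (i == j)%:R).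
  move=> Uu; have dX := smooth_differentiable sX Uu.
  apply: has_gradientB.
    exact: has_gradient_mulmx.
  have did : differentiable (@id 'rV[R]_n) u by [].
  have := has_gradient_coord j did.
  by move=> h; apply: has_gradient_eq h _ => i; rewrite /partial derive_id !mxE eqxx eq_sym.
(* This gives n e <= 1/2; n + 1 keeps the denominator nonzero for every n. *)
pose e : R := (2 * n.+1%:R)^-1.
have e0 : 0 < e by rewrite invr_gt0 mulr_gt0.
have nU : \forall u \near v, U u by exact: open_nbhs_nbhs.
have small (ij : 'I_n * 'I_n) :
    \forall u \near v, `|partial ij.1 (G ij.2) u| <= e.
  pose h u := (partial ij.1 X u *m B) 0 ij.2 - (ij.1 == ij.2)%:R.
  have dX1 := smooth_differentiable (smooth_partial ij.1 sX) Uv.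
  have dh : differentiable h v.
    have [dh _] := has_gradientB (has_gradient_mulmx B ij.2 dX1)
      (has_gradient_cst (ij.1 == ij.2)%:R v).
    exact: dh.
  have hv : h v = 0.
    move/matrixP: JB => /(_ ij.1 ij.2); rewrite /h => JB.
    have -> : partial ij.1 X v *m B = row ij.1 (\matrix_i partial i X v *m B).
      by rewrite row_mul rowK.
    by rewrite mxE JB mxE subrr.
  have : h @ v --> (0 : R) by rewrite -hv; exact: differentiable_continuous.
  move=> /cvgr0_norm_le/(_ _ e0) he.
  near=> u; rewrite (Ggrad _ _ _).2; first by near: u.
  by near: u.
have : \forall u \near v, U u /\ forall ij : 'I_n * 'I_n, `|partial ij.1 (G ij.2) u| <= e.
  have sm : \forall u \near v, forall ij : 'I_n * 'I_n, `|partial ij.1 (G ij.2) u| <= e.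
    exact: (@filter_forall _ _ (fun ij u => `|partial ij.1 (G ij.2) u| <= e)
      (nbhs v) _ small).
  exact: (@filterI _ (nbhs v) _ _ _ nU sm).
move=> /nbhs_ballP[r/= r0 rU].
have [K K0 BK] := mulmx_lipschitz B.
exists r, (2 * K); split => //; first by rewrite mulr_ge0.
move=> u u' ru ru'.
have Gle : `|(X u *m B - u) - (X u' *m B - u')| <= 2^-1 * `|u - u'|.
  rewrite normr_rowE ?mulr_ge0// ?invr_ge0//; apply/forallP => j.
  have := @small_partial_lipschitz (G j) v r e (ltW e0) _ _ u u' ru ru'.
  move=> le; have -> : (X u *m B - u - (X u' *m B - u')) 0 j = G j u - G j u'.
    by rewrite /G !mxE.
  apply: le_trans (le _ _) _.
  - by move=> w /rU[Uw _]; exact: (Ggrad _ _ Uw).1.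
  - by move=> w i /rU[_ /(_ (i, j))].
  apply: ler_wpM2r => //; rewrite /e invfM mulrCA ler_piMr ?invr_ge0//.
  by rewrite ler_pdivrMr// mul1r ler_nat.
have := BK (X u - X u'); rewrite mulmxBl.
have : `|u - u'| <= `|X u *m B - X u' *m B| + `|(X u *m B - u) - (X u' *m B - u')|.
  have {1}-> : u - u' = (X u *m B - X u' *m B) - ((X u *m B - u) - (X u' *m B - u')).
    by rewrite opprB addrC; apply/rowP => i; rewrite !mxE; ring.
  by apply: le_trans (ler_normB _ _) _.
move: Gle; lra.
Unshelve. all: by end_near. Qed.

End Immersion.

Lemma differentiable_approx (R : numFieldType) (V W : normedModType R)
    (f : V -> W) (a : V) (e : R) : differentiable f a -> 0 < e ->
  \forall x \near a, `|f x - f a - 'd f a (x - a)| <= e * `|x - a|.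
Proof.
move=> df e0; have /eqaddoP/(_ e e0) := diff_locally df.
move=> h; rewrite (near_shift 0 a) subr0 /=; apply: filterS h => h /=.
rewrite -[X in `|X| <= _ -> _]/(f (h + a) - (f a + 'd f a h)) addrK.
by rewrite opprD addrA.
Qed.

Section Patch.
Context (R : realType) (n m : nat).
Implicit Types (X : 'rV[R]_n -> 'rV[R]_m) (S : set 'rV[R]_n).

(** No continuous lift of gamma to S is available. The Lipschitz bound still places any preimage q
    of gamma s within O(s) of q1, so gamma s - gamma 0 = dX (q - q1) + o(s), and [cokermx J] kills
    the first term. *)
Lemma patch_tangent X S C q1 (gamma : R -> 'rV[R]_m) : 0 <= C ->
  (forall u u', S u -> S u' -> `|u - u'| <= C * `|X u - X u'|) ->
  differentiable X q1 -> S q1 -> gamma 0 = X q1 -> derivable gamma 0 1 ->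
  (\forall s \near (0 : R), (X @` S) (gamma s)) ->
  ('D_1 gamma 0 <= \matrix_(i < n) partial i X q1)%MS.
Proof.
move=> C0 SC dX Sq1 g0 dg gS; set J := \matrix_(i < n) _; set D := 'D_1 gamma 0.
have [K K0 HK] := mulmx_lipschitz (cokermx J).
have dgd : differentiable gamma 0 by exact/derivable1_diffP.
have dgE (s : R) : 'd gamma 0 s = s *: D.
  by rewrite /D deriveE// -linearZ/=; congr ('d gamma 0 _); rewrite /GRing.scale/= mulr1.
have dXJ v : 'd X q1 v *m cokermx J = 0.
  rewrite -deriveE// derive_sum_partial//.
  have -> : \sum_i v 0 i *: partial i X q1 = v *m J.
    by rewrite mulmx_sum_row; apply: eq_bigr => i _; rewrite rowK.
  by rewrite -mulmxA mulmx_coker mulmx0.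
(* The two remainders are at most e |q - q1| <= e C (|D| + 1) s and e s; [K] bounds the
   multiplication by [cokermx J]. *)
pose M := K * (C * (`|D| + 1) + 1).
have M0 : 0 <= M by rewrite mulr_ge0 ?addr_ge0 ?mulr_ge0 ?addr_ge0.
suff small (e : R) : 0 < e -> e <= 1 -> `|D *m cokermx J| <= e * M.
  rewrite submxE; apply/eqP/normr0_eq0/eqP; rewrite eq_le normr_ge0 andbT.
  rewrite leNgt; apply/negP => DK0.
  (* With this e, e M is at most half of the norm supposed to be positive. *)
  pose e := Num.min 1 (`|D *m cokermx J| / (2 * (M + 1))).
  have M1 : 0 < 2 * (M + 1) by rewrite mulr_gt0// ltr_wpDl.
  have e0 : 0 < e by rewrite lt_min ltr01 divr_gt0.
  have e1 : e <= 1 by rewrite ge_min lexx.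
  have := small e e0 e1.
  have e2 : e * (2 * (M + 1)) <= `|D *m cokermx J|.
    by rewrite -ler_pdivlMr// ge_min lexx orbT.
  move: e0 DK0 M0 e2; nra.
move=> e0 e1.
have A1 := differentiable_approx dgd e0.
have A2 : \forall s \near (0:R), forall q, S q -> gamma s = X q ->
    `|X q - X q1 - 'd X q1 (q - q1)| <= e * `|q - q1|.
  have /nbhs_ballP[r/= r0 rX] := differentiable_approx dX e0.
  have r1 : 0 < r / (C + 1) by rewrite divr_gt0// ltr_wpDl.
  have := differentiable_continuous dgd.
  move=> /cvgrPdist_lt/(_ _ r1); apply: filterS => s gs q Sq gq.
  apply: rX; rewrite -ball_normE /ball_/=; apply: le_lt_trans (SC _ _ Sq1 Sq) _.
  rewrite -gq -g0; move: gs; rewrite ltr_pdivlMr ?ltr_wpDl// mulrDr mulr1 mulrC.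
  by apply: le_lt_trans; rewrite lerDl.
have [r/= r0 rA] : exists2 r : R, 0 < r & forall s, ball 0 r s ->
  [/\ (X @` S) (gamma s), `|gamma s - gamma 0 - 'd gamma 0 (s - 0)| <= e * `|s - 0| &
   forall q, S q -> gamma s = X q ->
    `|X q - X q1 - 'd X q1 (q - q1)| <= e * `|q - q1|].
  have A : \forall s \near (0 : R), (X @` S) (gamma s) /\
      (`|gamma s - gamma 0 - 'd gamma 0 (s - 0)| <= e * `|s - 0| /\
       forall q, S q -> gamma s = X q ->
         `|X q - X q1 - 'd X q1 (q - q1)| <= e * `|q - q1|).
    exact: (@filterI _ (nbhs (0 : R)) _ _ _ gS (filterI A1 A2)).
  have [r/= r0 rA] := (nbhs_ballP _ _).1 A.
  by exists r => // s /rA [a1 [a2 a3]].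
have sr : ball 0 r (r / 2).
  rewrite -ball_normE /ball_/= sub0r normrN gtr0_norm ?divr_gt0//.
  by rewrite ltr_pdivrMr// ltr_pMr// ltr1n.
have [[q Sq Xq] g1 /(_ q Sq (esym Xq)) g2] := rA _ sr.
move: g1; rewrite subr0 dgE; set s := r / 2 => g1.
have s0 : 0 < s by rewrite divr_gt0.
have qs : `|q - q1| <= C * ((`|D| + e) * s).
  apply: le_trans (SC _ _ Sq Sq1) _; apply: ler_wpM2l => //.
  rewrite Xq -g0; move: g1; rewrite gtr0_norm// => g1.
  have -> : gamma s - gamma 0 = (gamma s - gamma 0 - s *: D) + s *: D by rewrite subrK.
  apply: le_trans (ler_normD _ _) _; rewrite normrZ gtr0_norm//; nra.
have g2K : `|(gamma s - gamma 0) *m cokermx J| <= K * (e * `|q - q1|).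
  have -> : (gamma s - gamma 0) *m cokermx J =
      (X q - X q1 - 'd X q1 (q - q1)) *m cokermx J.
    by rewrite [in RHS]mulmxBl dXJ subr0 Xq g0.
  by apply: le_trans (HK _) _; apply: ler_wpM2l.
have sDK : `|s *: (D *m cokermx J)| <= K * (e * `|q - q1|) + K * (e * s).
  have -> : s *: (D *m cokermx J) = (gamma s - gamma 0) *m cokermx J
      - (gamma s - gamma 0 - s *: D) *m cokermx J.
    by rewrite -mulmxBl opprB addrC subrK scalemxAl.
  apply: le_trans (ler_normB _ _) _; apply: lerD => //.
  apply: le_trans (HK _) _; apply: ler_wpM2l => //.
  by move: g1; rewrite (gtr0_norm s0).
rewrite -(ler_pM2l s0) -{1}(gtr0_norm s0) -normrZ.
apply: le_trans sDK _; rewrite /M -subr_ge0.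
have -> : s * (e * (K * (C * (`|D| + 1) + 1))) - (K * (e * `|q - q1|) + K * (e * s)) =
   K * e * (C * (`|D| + 1) * s - `|q - q1|) by ring.
apply: mulr_ge0; first by rewrite mulr_ge0// ltW.
rewrite subr_ge0; apply: le_trans qs _.
rewrite -mulrA; apply: ler_wpM2l => //; apply: ler_wpM2r; first exact: ltW.
by rewrite lerD2l.
Qed.

End Patch.

Section Cover.
Context (R : realType) (n m : nat).

(* All curves in S through a given point have velocities in a common subspace of
   dimension at most n. *)
Definition thin (S : set 'rV[R]_m) := forall y, S y ->
  exists W : 'M[R]_(n, m), forall gamma : R -> 'rV[R]_m, gamma 0 = y ->
    derivable gamma 0 1 -> (\forall s \near (0 : R), S (gamma s)) ->
    ('D_1 gamma 0 <= W)%MS.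

Context (M : manifold R n) (F : M -> 'rV[R]_m).
Hypothesis Fsmooth : forall k, atlas k -> smooth_on (chart_img k) (F \o chart_inv k).
Hypothesis Ffree : forall k, atlas k -> forall u, chart_img k u ->
  row_free (\matrix_(i < n) partial i (F \o chart_inv k) u).

(** The image of a whole chart need not be closed, but that of a closed ball is compact. Half of the
    smaller radius puts the closed ball both in the chart and in the ball where
    [immersion_lipschitz] applies. *)
Lemma local_thin (p : M) : exists D : set M, [/\ open D, D p &
  exists S, [/\ closed S, thin S & F @` D `<=` S]].
Proof.
have [k ak kp] := atlas_cover p.
have [odom oimg invK cfun _] := atlas_chart ak.
set v := chart_fun k p; have Uv : chart_img k v by exists p.
have [r1 [C [r10 C0 lip]]] := immersion_lipschitz oimg Uv (Fsmooth ak) (Ffree ak Uv).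
have /nbhs_ballP[r2/= r20 r2U] := open_nbhs_nbhs (conj oimg Uv).
pose r := Num.min r1 r2 / 2.
have m0 : 0 < Num.min r1 r2 by rewrite lt_min r10.
have r0 : 0 < r by rewrite divr_gt0.
have rm : r < Num.min r1 r2 by rewrite ltr_pdivrMr// ltr_pMr// ltr1n.
have sub1 : closed_ball v r `<=` ball v r1.
  by apply: closed_ball_subset => //; apply: lt_le_trans rm _; rewrite ge_min lexx.
have sub2 : closed_ball v r `<=` chart_img k.
  apply: subset_trans r2U; apply: closed_ball_subset => //.
  by apply: lt_le_trans rm _; rewrite ge_min lexx orbT.
exists (chart_dom k `&` chart_fun k @^-1` (ball v r)); split.
- rewrite openE => q [kq bq]; rewrite /interior; apply: filterI.
    exact: open_nbhs_nbhs.
  by apply: (cfun q kq); apply: open_nbhs_nbhs; split => //; exact: ball_open.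
- by split => //; exact: ballxx.
exists ((F \o chart_inv k) @` closed_ball v r); split.
- apply: compact_closed; first exact: norm_hausdorff.
  apply: continuous_compact.
    apply: continuous_in_subspaceT => u; rewrite inE => /sub2 Uu.
    exact/differentiable_continuous/(smooth_differentiable (Fsmooth ak)).
  apply: bounded_closed_compact; last exact: closed_ball_closed.
  exists (`|v| + r); split; first exact: num_real.
  move=> x xr u; rewrite closed_ballE// /closed_ball_/= => vu.
  rewrite -[u](subKr v); apply: le_trans (ler_normB _ _) _.
  by apply: le_trans (ltW xr); rewrite lerD2l.
- move=> _ [q bq <-]; exists (\matrix_(i < n) partial i (F \o chart_inv k) q).
  move=> gamma g0 dg gS; apply: (patch_tangent C0 _ _ bq g0 dg gS).
    by move=> u u' /sub1 bu /sub1 bu'; exact: lip.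
  exact: (smooth_differentiable (Fsmooth ak) (sub2 _ bq)).
- move=> _ [q [kq bq] <-]; exists (chart_fun k q) => /=; last by rewrite invK.
  exact: subset_closed_ball.
Qed.

(** Each basic open set of a countable base that lies in some set as in [local_thin] receives one
    closed thin set; indices that code no such basic set receive the empty set. *)
Lemma thin_cover : exists S : nat -> set 'rV[R]_m,
  (forall i, closed (S i) /\ thin (S i)) /\ forall p, exists i, S i (F p).
Proof.
have [B /countable_injP[f finj] [_ Bbasis]] := manifold_second_countable M.
pose good (U : set M) S := [/\ closed S, thin S & F @` U `<=` S].
have : forall i : nat, exists S, (closed S /\ thin S) /\
    forall U, B U -> f U = i -> (exists S', good U S') -> F @` U `<=` S.
  move=> i; have [[U [BU fU [S [cS tS FS]]]]|noU] :=
    pselect (exists U, [/\ B U, f U = i & exists S', good U S']).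
    exists S; split => // U' BU' fU' _.
    by rewrite (finj U' U) ?inE// fU'.
  exists set0; split; first by split; [exact: closed0 | move=> y []].
  by move=> U BU fU gU; exfalso; apply: noU; exists U.
move=> /choice[S HS]; exists S; split=> [i|p]; first exact: (HS i).1.
have [D [oD Dp [S' [cS' tS' FS']]]] := local_thin p.
have [U [BU Up] UD] := Bbasis p D (open_nbhs_nbhs (conj oD Dp)).
exists (f U); apply: ((HS (f U)).2 U BU erefl); last by exists p.
exists S'; split => //; apply: subset_trans FS'; exact: image_subset.
Qed.

End Cover.

(** * Rotations around a geodesic *)

Section PlaneRotation.
Context (R : realType) (n : nat) (a b : 'I_n) (ab : a != b).

Definition plane_id : 'M[R]_n := delta_mx a a + delta_mx b b.
Definition plane_turn : 'M[R]_n := delta_mx a b - delta_mx b a.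
(* A rotation of the plane spanned by the a-th and b-th coordinates, minus 1. *)
Definition plane_rot (t : R) : 'M[R]_n :=
  (cos t - 1) *: plane_id + sin t *: plane_turn.

Let ba : b != a. Proof. by rewrite eq_sym. Qed.

Let ii : plane_id *m plane_id = plane_id.
Proof.
by rewrite /plane_id mulmxDl !mulmxDr !mul_delta_mx !mul_delta_mx_0// addr0 add0r.
Qed.

Let it : plane_id *m plane_turn = plane_turn.
Proof.
rewrite /plane_id /plane_turn mulmxDl !mulmxBr !mul_delta_mx !mul_delta_mx_0//.
by rewrite subr0 sub0r.
Qed.

Let ti : plane_turn *m plane_id = plane_turn.
Proof.
rewrite /plane_id /plane_turn mulmxBl !mulmxDr !mul_delta_mx !mul_delta_mx_0//.
by rewrite addr0 add0r.
Qed.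

Let tt : plane_turn *m plane_turn = - plane_id.
Proof.
rewrite /plane_id /plane_turn mulmxBl !mulmxBr !mul_delta_mx !mul_delta_mx_0//.
by rewrite subr0 sub0r opprD.
Qed.

(** The addition law (1 + A)(1 + B) = 1 + C with the identity removed. *)
Lemma plane_rotD s t :
  plane_rot s + plane_rot t + plane_rot s *m plane_rot t = plane_rot (s + t).
Proof.
rewrite /plane_rot mulmxDl !mulmxDr -!scalemxAl -!scalemxAr ii it ti tt cosD sinD.
by move: plane_id plane_turn => L K; apply/matrixP => i j; rewrite !mxE; ring.
Qed.

Lemma plane_rot0 : plane_rot 0 = 0.
Proof. by rewrite /plane_rot cos0 sin0 subrr !scale0r addr0. Qed.

Lemma trmx_plane_rot t : (plane_rot t)^T = plane_rot (- t).
Proof.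
rewrite /plane_rot linearD/= !linearZ/= cosN sinN /plane_id /plane_turn.
by rewrite linearD linearB/= !trmx_delta -(opprB (delta_mx a b)) scalerN scaleNr.
Qed.

End PlaneRotation.

Section Axis.
Context (R : realType) (n : nat) (c : R) (x0 v0 : 'rV[R]_n.+2) (E : 'M[R]_(n, n.+2)).
Hypotheses (Mx0 : space_form c x0) (Tv0 : tangent c x0 v0).
Hypotheses (ET : forall b, tangent c x0 (row b E)).
Hypotheses (Ev : forall b, inner c (row b E) v0 = 0).
Hypotheses (EE : forall a b, inner c (row a E) (row b E) = (a == b)%:R).
Implicit Types (x y v : 'rV[R]_n.+2).

(* The coordinates of the component of a point orthogonal to the axis; for c = 0
   the origin of these coordinates is x0 and not 0. *)
Definition axis_coord : 'M[R]_(n.+2, n) :=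
  form_mx n c *m E^T
  - (if c == 0 then delta_mx 0 0 *m covector c E x0 else 0).

Lemma axis_basis0 b : c = 0 -> E b 0 = 0.
Proof. by move=> c0; have := ET b; rewrite /tangent c0 eqxx mxE. Qed.

Lemma axis_coord_tangent v : (c = 0 -> v 0 0 = 0) -> v *m axis_coord = covector c E v.
Proof.
move=> v00; rewrite /axis_coord mulmxBr mulmxA -/(covector c E v); case: eqP => [c0|_].
  by rewrite mulmxA -colE [col 0 v]mx11_scalar mxE v00// mul_scalar_mx scale0r subr0.
by rewrite mulmx0 subr0.
Qed.

Lemma axis_basis_coord : E *m axis_coord = 1%:M.
Proof.
apply/row_matrixP => b; rewrite row_mul axis_coord_tangent; last first.
  by rewrite mxE; exact: axis_basis0.
by apply/rowP => a; rewrite covectorE EE !mxE.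
Qed.

Lemma axis_point_coord : x0 *m axis_coord = 0.
Proof.
rewrite /axis_coord mulmxBr mulmxA -/(covector c E x0); case: eqP => [c0|/eqP c0].
  move: Mx0; rewrite /space_form /= c0 eqxx => x00.
  by rewrite mulmxA -colE [col 0 x0]mx11_scalar mxE x00 mul1mx subrr.
rewrite mulmx0 subr0; apply/rowP => b; rewrite covectorE mxE innerC.
by have := ET b; rewrite /tangent (negPf c0).
Qed.

Lemma axis_vector_coord : v0 *m axis_coord = 0.
Proof.
rewrite axis_coord_tangent; last by move=> c0; move: Tv0; rewrite /tangent c0 eqxx.
by apply/rowP => b; rewrite covectorE mxE innerC.
Qed.

Lemma axis_coordE y b : c * inner c (row b E) y = c * (y *m axis_coord) 0 b.
Proof.
rewrite /axis_coord mulmxBr mulmxA -/(covector c E y); case: eqP => [->|_].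
  by rewrite !mul0r.
by rewrite mulmx0 subr0 covectorE innerC.
Qed.

Section Rotation.
Context (a b : 'I_n) (ab : a != b).

(** Only the component orthogonal to the axis is turned, so points with zero [axis_coord] are fixed.
    For c = 0 the shift inside [axis_coord] makes this linear map act on x_0 = 1 as the rotation
    around an axis that may miss the origin of that hyperplane. *)
Definition axis_rot t : 'M[R]_n.+2 := 1%:M + axis_coord *m plane_rot a b t *m E.

Lemma axis_rotD s t : axis_rot s *m axis_rot t = axis_rot (s + t).
Proof.
rewrite /axis_rot -plane_rotD//; move: axis_basis_coord.
move: axis_coord (plane_rot a b s) (plane_rot a b t) => Z A B EZ.
rewrite mulmxDl mulmxDr mulmx1 mul1mx !mulmxDr !mulmxDl !mulmxA.
rewrite mulmx1 -(mulmxA (Z *m A) E) EZ mulmx1 -!addrA.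
by congr (_ + _); rewrite addrCA.
Qed.

Lemma axis_rot0 : axis_rot 0 = 1%:M.
Proof. by rewrite /axis_rot plane_rot0 mulmx0 mul0mx addr0. Qed.

Lemma axis_rot_unit t : axis_rot t \in unitmx.
Proof.
have /mulmx1_unit[] : axis_rot t *m axis_rot (- t) = 1%:M by rewrite axis_rotD subrr axis_rot0.
by [].
Qed.

Lemma inner_axis_rot t v : (c = 0 -> v 0 0 = 0) ->
  inner c (v *m axis_rot t) (v *m axis_rot t) = inner c v v.
Proof.
move=> v00; set z := covector c E v.
have -> : v *m axis_rot t = v + z *m plane_rot a b t *m E.
  by rewrite /axis_rot mulmxDr mulmx1 !mulmxA axis_coord_tangent.
have EJE : E *m form_mx n c *m E^T = 1%:M.
  by apply/matrixP => i j; rewrite -[LHS]/(gram c E i j) gramE EE mxE.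
pose p := z *m plane_rot a b t.
rewrite -/p innerDl !innerDr [inner c (p *m E) v]innerC !inner_mulmx.
have -> : covector c E (p *m E) = p.
  by rewrite /covector -(mulmxA (p *m E)) -(mulmxA p) (mulmxA E) EJE mulmx1.
have zp : (z *m p^T) 0 0 = (p *m z^T) 0 0.
  by rewrite -[LHS]trace_mx11 -mxtrace_tr trmx_mul trmxK trace_mx11.
(* W + W^T + W W^T = 0 is the orthogonality of 1 + W. *)
have := plane_rotD ab t (- t); rewrite subrr plane_rot0 -trmx_plane_rot => W0.
have : (z *m (plane_rot a b t + (plane_rot a b t)^T
    + plane_rot a b t *m (plane_rot a b t)^T) *m z^T) 0 0 = 0.
  by rewrite W0 mulmx0 mul0mx mxE.
have -> : z *m (plane_rot a b t + (plane_rot a b t)^T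
    + plane_rot a b t *m (plane_rot a b t)^T) *m z^T
    = p *m z^T + z *m p^T + p *m p^T.
  rewrite /p; move: (z) (plane_rot a b t) => z0 W.
  by rewrite !mulmxDr !mulmxDl trmx_mul !mulmxA.
have entryD (A B C : 'M[R]_1) : (A + B + C) 0 0 = A 0 0 + B 0 0 + C 0 0 by rewrite !mxE.
rewrite entryD => h; rewrite -/z -[RHS]addr0 -h !addrA -zp.
by rewrite -!addrA.
Qed.

Lemma axis_rot_coord0 t y : c = 0 -> (y *m axis_rot t) 0 0 = y 0 0.
Proof.
move=> c0; rewrite /axis_rot mulmxDr mulmx1 mxE [X in _ + X](_ : _ = 0) ?addr0//.
rewrite mulmxA mxE big1// => i _; by rewrite axis_basis0// mulr0.
Qed.

Lemma inner_axis_rot_point t y : inner c x0 (y *m axis_rot t) = inner c x0 y + 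
  (if c == 0 then inner c x0 (y *m axis_coord *m plane_rot a b t *m E) else 0).
Proof.
rewrite /axis_rot mulmxDr mulmx1 innerDr !mulmxA; congr (_ + _).
case: ifP => // c0; rewrite inner_mulmx (_ : covector c E x0 = 0) ?mul0mx ?mxE//.
apply/rowP => i; rewrite covectorE mxE innerC.
by have := ET i; rewrite /tangent c0.
Qed.

(** For c < 0 the sheet must be preserved too: [hyperboloid_sheet] reads it off the product with
    [x0], unchanged because the rotation moves y along rows of E, orthogonal to [x0]. *)
Lemma axis_rot_space_form t y : space_form c y -> space_form c (y *m axis_rot t).
Proof.
have [c0|c0] := eqVneq c 0.
  by rewrite /space_form/= (introT eqP c0) axis_rot_coord0.
move=> My; have [yy _] : inner c y y = c^-1 /\ (c < 0 -> 0 < y 0 0).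
  by move: My; rewrite /space_form /= (negPf c0).
have yy' : inner c (y *m axis_rot t) (y *m axis_rot t) = c^-1.
  by rewrite inner_axis_rot// => c00; rewrite c00 eqxx in c0.
rewrite /space_form /= (negPf c0); split => // cn.
rewrite (hyperboloid_sheet cn Mx0 yy') inner_axis_rot_point (negPf c0) addr0.
rewrite -(hyperboloid_sheet cn Mx0 yy).
by move: My; rewrite /space_form /= (negPf c0) => -[_]; exact.
Qed.

Lemma axis_rot_mem t : axis_group c (geodesic c x0 v0) (axis_rot t).
Proof.
split.
- split; first exact: axis_rot_space_form.
  move=> x v Mx Tv; apply: inner_axis_rot => c0.
  by move: Tv; rewrite /tangent c0 eqxx.
(* The determinant is positive as the square of that of the half-angle rotation. *)
- have -> : axis_rot t = axis_rot (t / 2) *m axis_rot (t / 2).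
    by rewrite axis_rotD -splitr.
  rewrite det_mulmx -expr2 lt_def sqr_ge0 andbT expf_neq0//.
  by rewrite -unitfE -unitmxE axis_rot_unit.
- move=> _ [_ [p [q ->]]]; rewrite /axis_rot mulmxDr mulmx1 !mulmxA mulmxDl.
  by rewrite -!scalemxAl axis_point_coord axis_vector_coord !scaler0 addr0 !mul0mx addr0.
Qed.

Definition axis_killing : 'M[R]_n.+2 := axis_coord *m plane_turn R a b *m E.

Lemma is_derive_axis_rot t y :
  is_derive (0 : R) 1 (fun s => y *m axis_rot (t + s)) (y *m axis_killing *m axis_rot t).
Proof.
pose A := y *m (axis_coord *m plane_id R a b *m E) *m axis_rot t.
pose B := y *m axis_killing *m axis_rot t.
have -> : (fun s => y *m axis_rot (t + s)) =
    (fun s : R => y *m axis_rot t + (cos s - 1) *: A + sin s *: B).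
  apply/funext => s; rewrite addrC -axis_rotD mulmxA {1}/axis_rot /plane_rot /A /B.
  rewrite /axis_killing; move: axis_coord (plane_id R a b) (plane_turn R a b).
  move: (axis_rot t) => T Z L K.
  rewrite !mulmxDr !mulmxDl !mulmxDr !mulmxDl mulmx1.
  by do 4 rewrite -?scalemxAr -?scalemxAl; rewrite !mulmxA addrA.
have cs : is_derive (0 : R) 1 (fun s : R => cos s - 1) 0.
  have := is_deriveB (is_derive_cos (0 : R)) (is_derive_cst (1 : R) (0 : R) 1).
  by rewrite sin0 oppr0 addr0.
have sn : is_derive (0 : R) 1 (fun s : R => sin s) 1.
  by have := is_derive_sin (0 : R); rewrite cos0.
have scale (f : R -> R) df (C : 'rV[R]_n.+2) : is_derive (0 : R) 1 f df ->
    is_derive (0 : R) 1 (fun s : R => f s *: C) (df *: C).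
  move=> [fd fdf]; have df1 : differentiable f 0 by exact/derivable1_diffP.
  split; first by apply/derivable1_diffP; exact: differentiableZl.
  by rewrite deriveE ?diffZl -?deriveE ?fdf//; exact: differentiableZl.
have := is_deriveD (is_deriveD (is_derive_cst (y *m axis_rot t) (0 : R) 1)
  (scale _ _ A cs)) (scale _ _ B sn).
by rewrite scale0r scale1r !add0r.
Qed.

End Rotation.
End Axis.

(* Needed to apply Baire's theorem to row vectors. *)
HB.instance Definition _ (R : realType) (m n : nat) :=
  Uniform_isComplete.Build 'M[R]_(m, n) cauchy_cvg.

(** * Differentiability of matrix-valued functions *)

Section MatrixDifferentiable.
Context (R : realType) (n : nat).
Implicit Types (u : 'rV[R]_n).

Definition mx_differentiable p q (A : 'rV[R]_n -> 'M[R]_(p, q)) u :=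
  forall i j, differentiable (fun w => A w i j) u.

Lemma mx_differentiable_cst p q (A : 'M[R]_(p, q)) u : mx_differentiable (fun=> A) u.
Proof. by move=> i j; exact: differentiable_cst. Qed.

Lemma mx_differentiable_row q (f : 'rV[R]_n -> 'rV[R]_q) u :
  differentiable f u -> mx_differentiable f u.
Proof. by move=> df i j; rewrite ord1; exact: (has_gradient_coord j df).1. Qed.

Lemma differentiable_row q (f : 'rV[R]_n -> 'rV[R]_q) u :
  mx_differentiable f u -> differentiable f u.
Proof.
move=> df; have -> : f = \sum_(j < q) (fun w => f w 0 j *: delta_mx 0 j).
  by apply/funext => w; rewrite fct_sumE {1}[f w]row_sum_delta.
by apply: differentiable_sum => j; apply: differentiableZl; exact: df.
Qed.

Lemma mx_differentiable_mul p q r (A : 'rV[R]_n -> 'M[R]_(p, q))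
    (B : 'rV[R]_n -> 'M[R]_(q, r)) u :
  mx_differentiable A u -> mx_differentiable B u ->
  mx_differentiable (fun w => A w *m B w) u.
Proof.
move=> dA dB i j.
have := has_gradient_sum (index_enum _) (fun k =>
  has_gradientM (has_gradientP (dA i k)) (has_gradientP (dB k j))).
rewrite (_ : (fun w => _) = (fun w => (A w *m B w) i j)); first by case.
by apply/funext => w; rewrite mxE.
Qed.

Lemma mx_differentiable_tr p q (A : 'rV[R]_n -> 'M[R]_(p, q)) u :
  mx_differentiable A u -> mx_differentiable (fun w => (A w)^T) u.
Proof.
move=> dA i j; rewrite (_ : (fun w => _) = (fun w => A w j i)); first exact: dA.
by apply/funext => w; rewrite mxE.
Qed.

Lemma mx_differentiableB p q (A B : 'rV[R]_n -> 'M[R]_(p, q)) u :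
  mx_differentiable A u -> mx_differentiable B u ->
  mx_differentiable (fun w => A w - B w) u.
Proof.
move=> dA dB i j; rewrite (_ : (fun w => _) = (fun w => A w i j - B w i j)).
  exact: differentiableB.
by apply/funext => w; rewrite !mxE.
Qed.

Lemma mx_differentiableD p q (A B : 'rV[R]_n -> 'M[R]_(p, q)) u :
  mx_differentiable A u -> mx_differentiable B u ->
  mx_differentiable (fun w => A w + B w) u.
Proof.
move=> dA dB i j; rewrite (_ : (fun w => _) = (fun w => A w i j + B w i j)).
  exact: differentiableD.
by apply/funext => w; rewrite !mxE.
Qed.

Lemma mx_differentiableZ p q (f : 'rV[R]_n -> R) (A : 'M[R]_(p, q)) u :
  differentiable f u -> mx_differentiable (fun w => f w *: A) u.
Proof.
move=> df i j; rewrite (_ : (fun w => _) = (fun w => f w * A i j)).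
  by apply: differentiableM => //; exact: differentiable_cst.
by apply/funext => w; rewrite !mxE.
Qed.

Lemma mx_differentiable_inv p (A : 'rV[R]_n -> 'M[R]_p) u :
  (\near u, A u \in unitmx) -> mx_differentiable A u ->
  mx_differentiable (fun w => invmx (A w)) u.
Proof. by move=> uA dA i j; exact: differentiable_invmx. Qed.

Lemma mx_differentiable_neq0 p q (A : 'rV[R]_n -> 'M[R]_(p, q)) u :
  mx_differentiable A u -> A u != 0 -> \forall w \near u, A w != 0.
Proof.
move=> dA Au; have [i [j Aij]] : exists i j, A u i j != 0.
  apply: contrapT => noij; move/eqP: Au; apply; apply/matrixP => i j.
  rewrite [RHS]mxE; apply/eqP; apply: contrapT => /negP Aij.
  by apply: noij; exists i, j.
have cA : A w i j @[w --> u] --> A u i j := differentiable_continuous (dA i j).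
have A0 : \forall w \near u, A w i j != 0 by exact: (@cvgr_neq0 _ _ _ (nbhs u) _ _ _ cA Aij).
by apply: (@filterS _ (nbhs u) _ _ _ _ A0) => w; apply: contra => /eqP ->; rewrite mxE.
Qed.

Lemma mx_differentiable_jacobian m (X : 'rV[R]_n -> 'rV[R]_m) u :
  (forall i, differentiable (partial i X) u) ->
  mx_differentiable (fun w => \matrix_(i < n) partial i X w) u.
Proof.
move=> dX i j; rewrite (_ : (fun w => _) = (fun w => partial i X w 0 j)).
  exact: mx_differentiable_row.
by apply/funext => w; rewrite mxE.
Qed.

End MatrixDifferentiable.

Lemma is_derive_mulmx (R : realType) (V : normedModType R) m p (f : V -> 'rV[R]_m)
    (Q : 'M[R]_(m, p)) x v df :
  is_derive x v f df -> is_derive x v (fun s => f s *m Q) (df *m Q).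
Proof.
move=> [fd fdf].
have entry j : is_derive x v (fun s => (f s *m Q) 0 j) ((df *m Q) 0 j).
  rewrite (_ : (fun s => _) = \sum_k (fun s => f s 0 k * Q k j)); last first.
    by apply/funext => s; rewrite fct_sumE mxE.
  rewrite mxE; apply: is_derive_sum => k.
  have fk : is_derive x v (fun s => f s 0 k) (df 0 k).
    split; first by move/derivable_mxP: fd; exact.
    by rewrite -fdf derive_mx// mxE.
  apply: (is_derive_eq (is_deriveM fk (is_derive_cst (Q k j) x v))).
  by rewrite scaler0 add0r; exact: mulrC.
have fQ : derivable (fun s => f s *m Q) x v.
  by apply/derivable_mxP => i j; rewrite ord1; case: (entry j).
split => //; rewrite derive_mx//; apply/rowP => j; rewrite mxE.
by case: (entry j).
Qed.

Lemma has_gradient_inner (R : realType) (n m : nat) (c : R)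
    (f g : 'rV[R]_n -> 'rV[R]_m.+2) u :
  differentiable f u -> differentiable g u ->
  has_gradient (fun w => inner c (f w) (g w)) u
    (fun i => inner c (partial i f u) (g u) + inner c (f u) (partial i g u)).
Proof.
move=> df dg; have fg j := has_gradientM (has_gradient_coord j df) (has_gradient_coord j dg).
have := has_gradientD (has_gradientZ (if c < 0 then -1 else 1) (fg 0))
  (has_gradient_sum (index_enum _) (fun j : 'I_m.+1 => fg (lift ord0 j))).
move=> h; apply: has_gradient_eq h _ => i; rewrite /inner big_split/=; ring.
Qed.

Lemma partial_tangent (R : realType) (n : nat) (c : R) (X : 'rV[R]_n -> 'rV[R]_n.+2) u i :
  (forall w, space_form c (X w)) -> differentiable X u ->
  tangent c (X u) (partial i X u).
Proof.
rewrite /space_form /tangent /= => XM dX; move: XM; case: eqP => [_|/eqP c0] XM.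
  rewrite -(has_gradient_coord 0 dX).2 (_ : (fun w => _) = fun=> 1).
    by rewrite (has_gradient_cst 1 u).2.
  by apply/funext => w; exact: XM.
have := (has_gradient_inner c dX dX).2 i.
rewrite (_ : (fun w => _) = fun=> c^-1); last by apply/funext => w; exact: (XM w).1.
rewrite (has_gradient_cst _ u).2 (innerC _ (X u)) => /esym/eqP.
by rewrite -mulr2n mulrn_eq0 /= => /eqP.
Qed.

(** * Tangency of the Killing fields *)

Section Tangency.
Context (R : realType) (n : nat) (c : R) (M : manifold R n) (F : M -> 'rV[R]_n.+2).
Hypothesis Fhyp : hypersurface c F.
Context (x0 v0 : 'rV[R]_n.+2) (E : 'M[R]_(n, n.+2)).
Hypotheses (Mx0 : space_form c x0) (Tv0 : tangent c x0 v0).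
Hypotheses (ET : forall b, tangent c x0 (row b E)).
Hypotheses (Ev : forall b, inner c (row b E) v0 = 0).
Hypotheses (EE : forall a b, inner c (row a E) (row b E) = (a == b)%:R).
Hypothesis Frot : forall Q, axis_group c (geodesic c x0 v0) Q ->
  forall p, range F (F p *m Q).

Context (k : chart R n M) (ak : atlas k) (a b : 'I_n) (ab : a != b).
Let U := chart_img k.
Let X := F \o chart_inv k.
Let J u := \matrix_(i < n) partial i X u.
Let Xsmooth : smooth_on U X. Proof. exact: (Fhyp.2 _ ak).1. Qed.
Let Jfree u : U u -> row_free (J u). Proof. exact: (Fhyp.2 _ ak).2. Qed.
Let U_open : open U. Proof. by case: (atlas_chart ak). Qed.
Let XM u : space_form c (X u). Proof. exact: Fhyp.1. Qed.
Let K := axis_killing c x0 E a b.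
Let Q := axis_rot c x0 E a b.

(** Turns y <= V into the vanishing of an expression differentiable in both arguments, which makes
    failure of tangency an open condition. *)
Definition frame_residue (V : 'M[R]_(n, n.+2)) (y : 'rV[R]_n.+2) :=
  y - covector c V y *m invmx (gram c V) *m V.

Lemma frame_residue_eq0 V y : gram c V \in unitmx ->
  (frame_residue V y == 0) = (y <= V)%MS.
Proof.
move=> ug; rewrite /frame_residue subr_eq0; apply/eqP/idP => [->|/submxP[r ->]].
  exact: submxMl.
by rewrite /covector -2!(mulmxA r) -/(gram c V) mulmxK.
Qed.

Lemma not_tangent_near u0 : U u0 -> ~~ (X u0 *m K <= J u0)%MS ->
  \forall u \near u0, U u /\ ~~ (X u *m K <= J u)%MS.
Proof.
move=> Uu0 nKJ.
have nU : \forall u \near u0, U u by exact: open_nbhs_nbhs.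
have gu u : U u -> gram c (J u) \in unitmx.
  move=> Uu; apply: (gram_unit (XM u)) => //; first exact: Jfree.
  move=> i; rewrite rowK; apply: partial_tangent => //.
  exact: smooth_differentiable Xsmooth Uu.
have dX := mx_differentiable_row (smooth_differentiable Xsmooth Uu0).
have dJ : mx_differentiable J u0.
  apply: mx_differentiable_jacobian => i.
  exact: smooth_differentiable (smooth_partial i Xsmooth) Uu0.
have dXK := mx_differentiable_mul dX (mx_differentiable_cst K u0).
have dFJ := mx_differentiable_mul (mx_differentiable_cst (form_mx n c) u0)
  (mx_differentiable_tr dJ).
have dgram : mx_differentiable (fun u => gram c (J u)) u0.
  have := mx_differentiable_mul dJ dFJ; rewrite /gram.
  by under eq_fun do rewrite mulmxA.
have dinv : mx_differentiable (fun u => invmx (gram c (J u))) u0.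
  apply: mx_differentiable_inv dgram.
  by apply: (@filterS _ (nbhs u0) _ _ _ _ nU) => u; exact: gu.
have dres : mx_differentiable (fun u => frame_residue (J u) (X u *m K)) u0.
  apply: mx_differentiableB => //; apply: mx_differentiable_mul => //.
  apply: mx_differentiable_mul => //.
  have := mx_differentiable_mul dXK dFJ; rewrite /covector.
  by under eq_fun do rewrite mulmxA.
have nz : frame_residue (J u0) (X u0 *m K) != 0.
  by rewrite frame_residue_eq0; [exact: nKJ | exact: gu].
have nres := mx_differentiable_neq0 dres nz.
apply: (@filterS _ (nbhs u0) _ _ _ _ (@filterI _ (nbhs u0) _ _ _ nU nres)).
move=> u [Uu]; rewrite frame_residue_eq0; last exact: gu.
by move=> nK; exact: conj Uu nK.
Qed.

(* If the Killing field were not tangent along the sheet X near u0, then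
   (t, u) |-> X u Q_t would be an immersion of dimension n + 1; its values lie in
   the image of F, which is a countable union of closed thin sets, so Baire's
   theorem puts an open set of them into a thin one. *)
Lemma killing_tangent u0 : U u0 -> (X u0 *m K <= J u0)%MS.
Proof.
move=> Uu0; apply: contrapT => /negP nKJ.
have /nbhs_closedballP[rp] := not_tangent_near Uu0 nKJ.
have r0 : 0 < rp%:num by [].
set r := rp%:num in r0 * => rU.
have [S [Sthin Scover]] := thin_cover (fun k ak => (Fhyp.2 k ak).1) (fun k ak => (Fhyp.2 k ak).2).
pose Psi (w : 'rV[R]_(1 + n)) := X (rsubmx w) *m Q (lsubmx w 0 0).
have Psi_diff w : U (rsubmx w) -> differentiable Psi w.
  move=> Uw; apply: differentiable_row; apply: mx_differentiable_mul.
    apply: mx_differentiable_row; apply: (@differentiable_comp _ _ _ _ rsubmx X).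
      exact: differentiable_rsubmx.
    exact: smooth_differentiable Xsmooth Uw.
  have did : differentiable (@id 'rV[R]_(1 + n)) w by [].
  have dt : has_gradient (fun w : 'rV[R]_(1 + n) => lsubmx w 0 0) w
      (fun i => partial i id w 0 (lshift n 0)).
    rewrite (_ : (fun w => _) = (fun w : 'rV[R]_(1 + n) => w 0 (lshift n 0))); last first.
      by apply/funext => w'; rewrite mxE.
    exact: has_gradient_coord did.
  apply: mx_differentiableD; first exact: mx_differentiable_cst.
  apply: mx_differentiable_mul; last exact: mx_differentiable_cst.
  apply: mx_differentiable_mul; first exact: mx_differentiable_cst.
  apply: mx_differentiableD; apply: mx_differentiableZ.
    have [dc _] := has_gradientB (has_gradient_comp (is_derive_cos _) dt) (has_gradient_cst 1 w).
    exact: dc.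
  exact: (has_gradient_comp (is_derive_sin _) dt).1.
(* The continuity of [Psi] is known only over the chart; restricting to a closed ball inside it
   makes each C i closed in the whole space. *)
pose C i := [set w : 'rV[R]_(1 + n) | closed_ball u0 r (rsubmx w) /\ S i (Psi w)].
have rsub_cont (w : 'rV[R]_(1 + n)) (B : set 'rV[R]_n) : open B -> B (rsubmx w) ->
    \forall w' \near w, B (rsubmx w').
  move=> oB Bw; have := differentiable_continuous (@differentiable_rsubmx R 1 1 n w).
  by apply; exact: open_nbhs_nbhs.
have Copen i : open (~` C i).
  rewrite openE => w nC; rewrite /interior.
  have [cb|ncb] := pselect (closed_ball u0 r (rsubmx w)); last first.
    have oB : open (~` closed_ball u0 r) by apply: closed_openC; exact: closed_ball_closed.
    have H := rsub_cont w _ oB ncb.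
    by apply: (@filterS _ (nbhs w) _ _ _ _ H) => w' nb [cb _]; exact: nb cb.
  have nS : (~` S i) (Psi w) by move=> Sw; apply: nC; split.
  have oS : open (~` S i) by apply: closed_openC; case: (Sthin i).
  have Pc := differentiable_continuous (Psi_diff w (rU _ cb).1).
  have H := Pc _ (open_nbhs_nbhs (conj oS nS)).
  by apply: (@filterS _ (nbhs w) _ _ _ _ H) => w' nS' [_ Sw]; exact: nS' Sw.
(* Otherwise all complements of the C i are open and dense, and Baire gives a point over the open
   ball outside every C i. But its image under [Psi] is a rotated point of the image of F, hence in
   some S i. *)
have [i [D [D0 oD DC]]] : exists i D, [/\ D !=set0, open D & D `<=` C i].
  apply: contrapT => noD.
  have dC i : open (~` C i) /\ dense (~` C i).
    split; first exact: Copen.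
    move=> D D0 oD; apply: contrapT => DC; apply: noD; exists i, D; split => // w Dw.
    by apply: contrapT => Cw; apply: DC; exists w.
  have := Baire dC; move=> /(_ [set w | ball u0 r (rsubmx w)]) [| |w [bw Cw]].
  - by exists (row_mx 0 u0); rewrite /= row_mxKr; exact: ballxx.
  - rewrite openE => w bw; rewrite /interior.
    have oB : open (ball u0 r) by exact: ball_open.
    exact: rsub_cont oB bw.
  have [q _ Fq] := Frot (axis_rot_mem Mx0 Tv0 ET Ev EE ab (lsubmx w 0 0)) (chart_inv k (rsubmx w)).
  have [i Sq] := Scover q; apply: (Cw i I); split; first exact: subset_closed_ball.
  by rewrite /Psi/= -Fq.
have [w1 Dw1] := D0; set u1 := rsubmx w1; set t1 := lsubmx w1 0 0.
have [/rU[Uu1 nK1] S1] := DC _ Dw1.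
have [W HW] := (Sthin i).2 _ S1.
have line (d : 'rV[R]_(1 + n)) : \forall s \near (0 : R), S i (Psi (w1 + s *: d)).
  have dl : differentiable (fun s : R => w1 + s *: d) 0.
    apply: (@differentiableD _ _ _ (cst w1) (fun s : R => s *: d)).
      exact: differentiable_cst.
    by apply: differentiableZl; exact: ex_diff.
  have cl : (w1 + s *: d) @[s --> (0 : R)] --> w1 + 0 *: d := differentiable_continuous dl.
  rewrite scale0r addr0 in cl; have H := cl _ (open_nbhs_nbhs (conj oD Dw1)).
  by apply: (@filterS _ (nbhs (0 : R)) _ _ _ _ H) => s /DC[_ Ss]; exact: Ss.
have PsiE (e : R) (d : 'rV[R]_n) s : Psi (w1 + s *: row_mx e%:M d) =
    X (u1 + s *: d) *m Q (t1 + s * e).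
  have rE : rsubmx (w1 + s *: row_mx e%:M d) = u1 + s *: d.
    by rewrite linearD linearZ/= row_mxKr.
  have lE : lsubmx (w1 + s *: row_mx e%:M d) 0 0 = t1 + s * e.
    rewrite linearD linearZ/= row_mxKl [LHS]mxE; congr (_ + _).
    by rewrite !mxE eqxx mulr1n.
  by rewrite /Psi rE lE.
have along (d : 'rV[R]_(1 + n)) y :
    is_derive (0 : R) 1 (fun s => Psi (w1 + s *: d)) y -> (y <= W)%MS.
  move=> [dg <-]; apply: (HW _ _ dg (line d)).
  by rewrite scale0r addr0.
have JW : (J u1 *m Q t1 <= W)%MS.
  apply/row_subP => j; rewrite row_mul rowK; apply: (along (row_mx 0%:M (delta_mx 0 j))).
  under eq_fun do rewrite PsiE mulr0 addr0.
  apply: is_derive_mulmx.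
  have := @is_derive_line R _ _ X u1 (delta_mx 0 j) 0.
  rewrite scale0r addr0; apply; exact: smooth_differentiable Xsmooth Uu1.
have KW : (X u1 *m K *m Q t1 <= W)%MS.
  apply: (along (row_mx 1%:M 0)).
  under eq_fun do rewrite PsiE mulr1 scaler0 addr0.
  exact: is_derive_axis_rot.
have Qu : Q t1 \in unitmx by exact: axis_rot_unit.
have rJ : \rank (J u1 *m Q t1) = n.
  by rewrite mxrankMfree ?row_free_unit//; apply/eqP/Jfree.
(* W has rank at most n and contains the rotated tangent space, which already has rank n; so W
   contains nothing else, in particular no transversal Killing direction. *)
have WJ : (W <= J u1 *m Q t1)%MS.
  by rewrite -(mxrank_leqif_sup JW).2 rJ eqn_leq; rewrite -{1}rJ mxrankS//= rank_leq_row.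
have /submxP[Y KY] := submx_trans KW WJ.
move/negP: nK1; apply; apply/submxP; exists Y.
by apply: (can_inj (mulmxK Qu)); rewrite KY mulmxA.
Qed.

End Tangency.

(** * Geometry of the hypersurface in one chart *)

Lemma near_eq_partial (R : realType) (n : nat) (V : normedModType R) i
    (f h : 'rV[R]_n -> V) u :
  (\forall w \near u, f w = h w) -> partial i f u = partial i h u.
Proof. exact: near_eq_derive. Qed.

(* Unification would otherwise try to compare distinct derivatives by unfolding them. *)
Local Opaque partial.

Section LocalRotation.
Context (R : realType) (n : nat) (c : R) (U : set 'rV[R]_n) (X : 'rV[R]_n -> 'rV[R]_n.+2).
Hypotheses (U_open : open U) (Xsmooth : smooth_on U X).
Hypothesis XM : forall u, space_form c (X u).
Let V u := \matrix_(i < n) partial i X u.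
Hypothesis Vfree : forall u, U u -> row_free (V u).
Let g u := gram c (V u).
Let N u := normal c X u.
Let H u := second_form c X u.

Let dX u : U u -> differentiable X u.
Proof. exact: smooth_differentiable. Qed.

Let dXi i u : U u -> differentiable (partial i X) u.
Proof. by move=> Uu; exact: smooth_differentiable (smooth_partial i Xsmooth) Uu. Qed.

Let dXij i j u : U u -> differentiable (partial i (partial j X)) u.
Proof.
by move=> Uu; exact: smooth_differentiable (smooth_partial i (smooth_partial j Xsmooth)) Uu.
Qed.

Let nearU u : U u -> \forall w \near u, U w.
Proof. by move=> Uu; exact: open_nbhs_nbhs. Qed.

Lemma metric_gram u : metric c X u = g u.
Proof. by apply/matrixP => i j; rewrite /g gramE !rowK mxE. Qed.

Lemma row_tangent u : U u -> forall i, tangent c (X u) (row i (V u)).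
Proof. by move=> Uu i; rewrite rowK; apply: partial_tangent => //; exact: dX. Qed.

Lemma normalP u : U u -> [/\ tangent c (X u) (N u), inner c (N u) (N u) = 1 &
  forall i, inner c (N u) (row i (V u)) = 0].
Proof.
move=> Uu; have [y [yT yy yV]] := exists_unit_normal (V u) (XM u) (leqnn n).
have /(xgetPex 0) : unit_normal c X u !=set0.
  by exists y; split => // i; rewrite -(rowK (fun i => partial i X u)); exact: yV.
by move=> [NT NN NX]; split => // i; rewrite rowK; exact: NX.
Qed.

Lemma metric_unit u : U u -> g u \in unitmx.
Proof. by move=> Uu; apply: (gram_unit (XM u)); [exact: Vfree | exact: row_tangent]. Qed.

Lemma partial_coord j l u : U u -> partial j (fun w => X w 0 l) u = partial j X u 0 l.
Proof. by move=> Uu; exact: (has_gradient_coord l (dX Uu)).2. Qed.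

Lemma partial2_coord i j l u : U u ->
  partial i (partial j (fun w => X w 0 l)) u = partial i (partial j X) u 0 l.
Proof.
move=> Uu; rewrite -(has_gradient_coord l (dXi j Uu)).2; apply: near_eq_partial.
by apply: (@filterS _ (nbhs u) _ _ _ _ (nearU Uu)) => w Uw; exact: partial_coord.
Qed.

Lemma partial_sym i j u : U u -> partial i (partial j X) u = partial j (partial i X) u.
Proof.
move=> Uu.
suff : forall l, partial i (partial j X) u 0 l = partial j (partial i X) u 0 l.
  by move: (partial i _ u) (partial j _ u) => A B; move/rowP.
move=> l.
refine (etrans (esym (partial2_coord i j l Uu)) _).
refine (etrans _ (partial2_coord j i l Uu)).
have d1 k w : U w -> differentiable (partial k (fun w => X w 0 l)) w.
  move=> Uw; apply: near_eq_differentiable (has_gradient_coord l (dXi k Uw)).1.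
  apply: (@filterS _ (nbhs w) _ _ _ _ (nearU Uw)) => w' Uw'.
  exact/esym/partial_coord.
have c2 k k' : {for u, continuous (partial k (partial k' (fun w => X w 0 l)))}.
  apply: differentiable_continuous.
  apply: near_eq_differentiable (has_gradient_coord l (dXij k k' Uu)).1.
  apply: (@filterS _ (nbhs u) _ _ _ _ (nearU Uu)) => w Uw.
  exact/esym/partial2_coord.
apply: (@partialC R n (fun w => X w 0 l) i j u _ _ _ (c2 i j) (c2 j i)).
- apply: (@filterS _ (nbhs u) _ _ _ _ (nearU Uu)) => w Uw.
  exact: (has_gradient_coord l (dX Uw)).1.
- by apply: (@filterS _ (nbhs u) _ _ _ _ (nearU Uu)) => w Uw; exact: d1.
- by apply: (@filterS _ (nbhs u) _ _ _ _ (nearU Uu)) => w Uw; exact: d1.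
Qed.

Lemma second_form_sym u : U u -> (H u)^T = H u.
Proof. by move=> Uu; apply/matrixP => i j; rewrite !mxE partial_sym. Qed.

Lemma has_gradient_metric u i j : U u ->
  has_gradient (fun w => metric c X w i j) u (fun k =>
    inner c (partial k (partial i X) u) (partial j X u)
    + inner c (partial i X u) (partial k (partial j X) u)).
Proof.
move=> Uu; rewrite (_ : (fun w => _) =
  (fun w => inner c (partial i X w) (partial j X w))).
  exact: has_gradient_inner (dXi i Uu) (dXi j Uu).
by apply/funext => w; rewrite mxE.
Qed.

(** Gauss formula: derivatives of the metric are sums of products <X_ij, X_l>, and the symmetry in
    i, j leaves only the tangential part of X_ij. *)
Lemma christoffelE u k i j : U u -> christoffel c X k i j u =
  (covector c (V u) (partial i (partial j X) u) *m invmx (g u)) 0 k.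
Proof.
move=> Uu; pose S a b e := inner c (partial a (partial b X) u) (partial e X u).
have symS a b e : S a b e = S b a e by rewrite /S (partial_sym a b Uu).
have dg a b e : partial a (fun w => metric c X w b e) u = S a b e + S a e b.
  by rewrite (has_gradient_metric b e Uu).2; congr (_ + _); exact: innerC.
rewrite /christoffel mxE mulr_sumr; apply: eq_bigr => l _.
rewrite (dg i j l) (dg j i l) (dg l i j) metric_gram covectorE rowK.
rewrite -[inner _ _ _]/(S i j l).
have -> : invmx (g u) l k = invmx (g u) k l.
  by rewrite -[in LHS](trmxK (invmx (g u))) trmx_inv trmx_gram mxE.
move: S symS (invmx _ _ _) {dg} => S symS x.
by rewrite (symS j i l) (symS l i j) (symS l j i); field.
Qed.

(** The derivative of c <X_j, X> = 0 in the direction i. *)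
Lemma c_inner_partial2 u i j : U u ->
  c * inner c (partial i (partial j X) u) (X u) = - (c * g u i j).
Proof.
move=> Uu; have zero w : U w -> c * inner c (partial j X w) (X w) = 0.
  by move=> Uw; apply: c_inner_tangent; apply: partial_tangent => //; exact: dX.
have [_ /(_ i)] := has_gradientZ c (has_gradient_inner c (dXi j Uu) (dX Uu)).
have -> : partial i (fun w => c * inner c (partial j X w) (X w)) u = 0.
  have [_ cst0] := has_gradient_cst (0 : R) u.
  rewrite -[RHS](cst0 i); apply: near_eq_partial.
  by apply: (@filterS _ (nbhs u) _ _ _ _ (nearU Uu)) => w; exact: zero.
rewrite mulrDr (innerC _ (partial j X u)) /g gramE !rowK => /esym/eqP.
by rewrite addr_eq0 => /eqP.
Qed.

(** * Consequences of minimality and of rotational symmetry *)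

Hypothesis Xmin : forall u, U u -> \tr (invmx (g u) *m H u) = 0.
Context (x0 : 'rV[R]_n.+2) (E : 'M[R]_(n, n.+2)).
Hypotheses (ET : forall b, tangent c x0 (row b E)).
Hypotheses (EE : forall a b, inner c (row a E) (row b E) = (a == b)%:R).
Hypothesis XK : forall u a b, U u -> a != b ->
  (X u *m axis_killing c x0 E a b <= V u)%MS.

Let VT u (Uu : U u) := row_tangent Uu.
Let NP u (Uu : U u) := normalP Uu.
Let gunit u (Uu : U u) := metric_unit Uu.

Let z u := X u *m axis_coord c x0 E.
Let P u := V u *m form_mx n c *m E^T.
Let w u := \row_b inner c (N u) (row b E).
Let d u := z u *m (P u)^T.
Let rho u : R := (z u *m (z u)^T) 0 0.
Let nu u : R := (z u *m (w u)^T) 0 0.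

Let PE u i b : P u i b = inner c (partial i X u) (row b E).
Proof.
rewrite -(rowK (fun i => partial i X u) i) inner_row -mulmxA -row_mul mulmxA.
by rewrite [RHS]mxE.
Qed.

Let tangent_coord0 (x y : 'rV[R]_n.+2) : c = 0 -> tangent c x y -> y 0 0 = 0.
Proof. by rewrite /tangent => ->; rewrite eqxx. Qed.

Let rhoE u : rho u = \sum_a z u 0 a * z u 0 a.
Proof. by rewrite /rho [LHS]mxE; apply: eq_bigr => a _; rewrite [X in _ * X]mxE. Qed.

Let nuE u : nu u = \sum_a z u 0 a * w u 0 a.
Proof. by rewrite /nu [LHS]mxE; apply: eq_bigr => a _; rewrite [X in _ * X]mxE. Qed.

Lemma axis_gram u : U u -> (P u)^T *m invmx (g u) *m P u =
  1%:M - (w u)^T *m w u - c *: ((z u)^T *m z u).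
Proof.
move=> Uu; have [NT NN NV] := NP Uu.
apply: (basis_gram (XM u) (Vfree Uu) (VT Uu) NT NN NV) => //.
  by move=> b c0; exact: axis_basis0 ET b c0.
by move=> b; exact: axis_coordE.
Qed.

Lemma has_gradient_axis_coord u b : U u ->
  has_gradient (fun w => z w 0 b) u (fun i => P u i b).
Proof.
move=> Uu; apply: has_gradient_eq (has_gradient_mulmx _ b (dX Uu)) _ => i.
rewrite axis_coord_tangent; first by rewrite PE covectorE.
by move=> c0; apply: (tangent_coord0 c0 (x := X u)); rewrite -(rowK (fun i => partial i X u)); exact: VT.
Qed.

Lemma killing_coord u a b : a != b -> X u *m axis_killing c x0 E a b =
  z u 0 a *: row b E - z u 0 b *: row a E.
Proof.
move=> ab; rewrite /axis_killing /plane_turn !mulmxA -/(z u) mulmxBr mulmxBl.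
have D i j : z u *m delta_mx i j *m E = z u 0 i *: row j E.
  by rewrite -(mul_delta_mx (0 : 'I_1)) mulmxA -colE [col i _]mx11_scalar mxE
    mul_scalar_mx -scalemxAl -rowE.
by rewrite !D.
Qed.

(** The Killing field z_a e_b - z_b e_a is orthogonal to the normal, that is z_a w_b = z_b w_a;
    multiply by z_a and sum over a. *)
Lemma axis_normal u : U u -> rho u *: w u = nu u *: z u.
Proof.
move=> Uu; have [NT NN NV] := NP Uu.
have ab a b : z u 0 a * w u 0 b = z u 0 b * w u 0 a.
  have [->//|nab] := eqVneq a b.
  have /submxP[D KD] := XK Uu nab; have := congr1 (inner c (N u)) KD.
  rewrite inner_mulmx (_ : covector c (V u) (N u) = 0) ?mul0mx; last first.
    by apply/rowP => i; rewrite covectorE NV mxE.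
  rewrite killing_coord// innerDr innerNr !innerZr [RHS]mxE => /eqP.
  by rewrite subr_eq0 [w u 0 b]mxE [w u 0 a]mxE => /eqP.
apply/rowP => b; rewrite [LHS]mxE [RHS]mxE rhoE nuE !mulr_suml.
by apply: eq_bigr => a _; rewrite -!mulrA ab (mulrC (w u 0 a)).
Qed.

Lemma mx_differentiable_frame u : U u -> mx_differentiable V u.
Proof. by move=> Uu; apply: mx_differentiable_jacobian => i; exact: dXi. Qed.

Lemma mx_differentiable_covector q (y : 'rV[R]_n -> 'M[R]_(q, n.+2)) u : U u ->
  mx_differentiable y u -> mx_differentiable (fun v => y v *m form_mx n c *m (V v)^T) u.
Proof.
move=> Uu dy; apply: mx_differentiable_mul.
  by apply: mx_differentiable_mul => //; exact: mx_differentiable_cst.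
by apply: mx_differentiable_tr; exact: mx_differentiable_frame.
Qed.

Lemma mx_differentiable_invmetric u : U u -> mx_differentiable (fun v => invmx (g v)) u.
Proof.
move=> Uu; apply: mx_differentiable_inv.
  by apply: (@filterS _ (nbhs u) _ _ _ _ (nearU Uu)) => v Uv; exact: gunit.
by apply: mx_differentiable_covector => //; exact: mx_differentiable_frame.
Qed.

Lemma covector_axis_basis u b : covector c (V u) (row b E) = row b (P u)^T.
Proof. by apply/rowP => i; rewrite covectorE rowK innerC -PE !mxE. Qed.

(* The normal component of the derivative of the tangent field X K, with K the
   infinitesimal rotation in the plane of rows a and b of E. *)
Lemma killing_eigen u a b : U u ->
  (z u 0 a *: row b (P u)^T - z u 0 b *: row a (P u)^T) *m invmx (g u) *m H u
  = w u 0 b *: row a (P u)^T - w u 0 a *: row b (P u)^T.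
Proof.
have [->|ab] := eqVneq a b; first by move=> _; rewrite !subrr !mul0mx.
move=> Uu; have [NT NN NV] := NP Uu.
set K := axis_killing c x0 E a b.
pose xi v := covector c (V v) (X v *m K) *m invmx (g v).
have xiV v : U v -> X v *m K = xi v *m V v.
  move=> Uv; apply/eqP; rewrite -subr_eq0 -[X in X == _]/(frame_residue c (V v) (X v *m K)).
  by rewrite frame_residue_eq0; [exact: XK | exact: gunit].
have dxi : mx_differentiable xi u.
  apply: mx_differentiable_mul; last exact: mx_differentiable_invmetric.
  apply: mx_differentiable_covector => //; apply: mx_differentiable_mul.
    exact: mx_differentiable_row (dX Uu).
  exact: mx_differentiable_cst.
(* The normal is frozen at [u]; terms in which the derivative falls on [xi] vanish there, the frame
   at [u] being orthogonal to it. *)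
pose B := form_mx n c *m (N u)^T.
have B0 y : (y *m B) 0 0 = inner c y (N u) by rewrite inner_mx mulmxA.
have grad1 := has_gradient_mulmx (K *m B) 0 (dX Uu).
have grad2 := has_gradient_sum (index_enum 'I_n) (fun k =>
  has_gradientM (has_gradientP (dxi 0 k)) (has_gradient_mulmx B 0 (dXi k Uu))).
have same : \forall v \near u, \sum_k xi v 0 k * (partial k X v *m B) 0 0 =
    (X v *m (K *m B)) 0 0.
  apply: (@filterS _ (nbhs u) _ _ _ _ (nearU Uu)) => v Uv.
  rewrite mulmxA (xiV v Uv) -mulmxA mxE; apply: eq_bigr => k _.
  congr (_ * _); transitivity ((row k (V v *m B)) 0 0); first by rewrite row_mul rowK.
  by rewrite [LHS]mxE.
have [_ grad2'] := has_gradient_near same grad2.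
have key i : inner c (partial i X u *m K) (N u) = \sum_k xi u 0 k * H u i k.
  rewrite -B0 -mulmxA -(grad1.2 i) (grad2' i); apply: eq_bigr => k _.
  have XN : (partial k X u *m B) 0 0 = 0.
    by rewrite B0 innerC -(rowK (fun i => partial i X u)) NV.
  by rewrite XN mulr0 add0r B0 /H /second_form [in RHS]mxE.
have xiE : xi u = (z u 0 a *: row b (P u)^T - z u 0 b *: row a (P u)^T) *m invmx (g u).
  rewrite /xi killing_coord//; congr (_ *m _).
  by rewrite -!covector_axis_basis /covector !mulmxBl -!scalemxAl.
rewrite -xiE; apply/rowP => i; rewrite [LHS]mxE.
have -> : \sum_k xi u 0 k * H u k i = inner c (partial i X u *m K) (N u).
  rewrite key; apply: eq_bigr => k _; congr (_ * _).
  by rewrite -[in LHS](second_form_sym Uu) mxE.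
have -> : partial i X u *m K = P u i a *: row b E - P u i b *: row a E.
  rewrite /K /axis_killing /plane_turn !mulmxA axis_coord_tangent; last first.
    move=> c0; apply: (tangent_coord0 c0 (x := X u)).
    by rewrite -(rowK (fun i => partial i X u)); exact: VT.
  rewrite mulmxBr mulmxBl.
  have D j k : covector c E (partial i X u) *m delta_mx j k *m E = P u i j *: row k E.
    rewrite -(mul_delta_mx (0 : 'I_1)) mulmxA -colE [col j _]mx11_scalar.
    by rewrite [col j _ _ _]mxE mul_scalar_mx -scalemxAl -rowE covectorE PE.
  by rewrite !D.
have wE j : inner c (row j E) (N u) = w u 0 j by rewrite innerC [RHS]mxE.
have subE (A A' : 'rV[R]_n) s t : (s *: A - t *: A') 0 i = s * A 0 i - t * A' 0 i.
  by rewrite !mxE.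
have rowP' j : row j (P u)^T 0 i = P u i j by rewrite 2![LHS]mxE.
by rewrite subE !rowP' innerDl innerNl !innerZl !wE mulrC (mulrC (P u i b)).
Qed.

(** The sum over a of z_a times [killing_eigen]. *)
Lemma shape_eigen u : U u ->
  (rho u *: (P u)^T - (z u)^T *m d u) *m invmx (g u) *m H u
  = (w u)^T *m d u - nu u *: (P u)^T.
Proof.
move=> Uu; apply/row_matrixP => b.
have dE : d u = \sum_a z u 0 a *: row a (P u)^T by rewrite /d mulmx_sum_row.
have rowT (y : 'rV[R]_n) : row b (y^T *m d u) = y 0 b *: d u.
  by rewrite row_mul [row b _]mx11_scalar mul_scalar_mx !mxE.
have rowL (A A' : 'M[R]_n) s t : row b (s *: A - t *: A') = s *: row b A - t *: row b A'.
  by rewrite linearB !linearZ.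
rewrite -mulmxA row_mul -[(z u)^T *m _]scale1r rowL scale1r.
rewrite -[(w u)^T *m _]scale1r rowL scale1r !rowT.
have -> : rho u *: row b (P u)^T - z u 0 b *: d u =
    \sum_a z u 0 a *: (z u 0 a *: row b (P u)^T - z u 0 b *: row a (P u)^T).
  rewrite rhoE dE scaler_suml scaler_sumr -sumrB; apply: eq_bigr => a _.
  by rewrite scalerBr !scalerA (mulrC (z u 0 b)).
rewrite mulmxA !mulmx_suml.
have -> : w u 0 b *: d u - nu u *: row b (P u)^T = \sum_a
    z u 0 a *: (w u 0 b *: row a (P u)^T - w u 0 a *: row b (P u)^T).
  rewrite nuE dE scaler_suml scaler_sumr -sumrB; apply: eq_bigr => a _.
  by rewrite scalerBr !scalerA (mulrC (w u 0 b)).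
by apply: eq_bigr => a _; rewrite -!scalemxAl killing_eigen.
Qed.

(** * Gradient and Hessian of rho *)

Let zv u := z u *m E.
(** Half the gradient vector of rho; [s] is then |grad rho|^2 / 4. *)
Let omega u := d u *m invmx (g u).
Let s u : R := (omega u *m (d u)^T) 0 0.

Lemma has_gradient_axis_normsq u : U u -> has_gradient rho u (fun i => 2 * d u 0 i).
Proof.
move=> Uu; have -> : rho = (fun v => \sum_b z v 0 b * z v 0 b) by apply/funext => v; exact: rhoE.
have zb b := has_gradient_axis_coord b Uu.
have := has_gradient_sum (index_enum 'I_n) (fun b => has_gradientM (zb b) (zb b)).
move=> h; apply: has_gradient_eq h _ => i; rewrite /d [in RHS]mxE mulr_sumr.
apply: eq_bigr => b _; rewrite [_^T _ _]mxE; move: (z u 0 b) (P u i b) => x y; ring.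
Qed.

Lemma has_gradient_frame_axis u j b : U u ->
  has_gradient (fun v => P v j b) u (fun i => inner c (partial i (partial j X) u) (row b E)).
Proof.
move=> Uu; have -> : (fun v => P v j b) = (fun v => inner c (partial j X v) (row b E)).
  by apply/funext => v; exact: PE.
have := has_gradient_inner c (dXi j Uu) (differentiable_cst (row b E) u).
move=> h; apply: has_gradient_eq h _ => i.
by rewrite [X in _ + inner c _ X]derive_cst inner0r addr0.
Qed.

Lemma has_gradient_radial u j : U u -> has_gradient (fun v => d v 0 j) u
  (fun i => (P u *m (P u)^T) i j + inner c (partial i (partial j X) u) (zv u)).
Proof.
move=> Uu; have -> : (fun v => d v 0 j) = (fun v => \sum_b z v 0 b * P v j b).
  by apply/funext => v; rewrite /d mxE; apply: eq_bigr => b _; rewrite [X in _ * X]mxE.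
have := has_gradient_sum (index_enum 'I_n) (fun b =>
  has_gradientM (has_gradient_axis_coord b Uu) (has_gradient_frame_axis j b Uu)).
move=> h; apply: has_gradient_eq h _ => i; rewrite big_split/=; congr (_ + _).
  by rewrite [RHS]mxE; apply: eq_bigr => b _; congr (_ * _); rewrite [RHS]mxE.
rewrite /zv mulmx_sum_row inner_sumr; apply: eq_bigr => b _.
by rewrite innerZr.
Qed.

Let dT u : d u = covector c (V u) (zv u).
Proof.
rewrite /zv mulmx_sum_row /covector !mulmx_suml /d mulmx_sum_row.
by apply: eq_bigr => b _; rewrite -!scalemxAl -covector_axis_basis.
Qed.

(** The first term on the right is the Christoffel correction. With [has_gradient_radial], half the
    covariant Hessian of rho is therefore P P^T + nu H - c rho g. *)
Lemma radial_decomposition u i j : U u ->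
  inner c (partial i (partial j X) u) (zv u) =
  inner c (partial i (partial j X) u) (omega u *m V u) + nu u * H u i j
  - c * rho u * g u i j.
Proof.
move=> Uu; have [NT NN NV] := NP Uu.
have zv0 : c = 0 -> zv u 0 0 = 0.
  by move=> c0; rewrite /zv mxE big1// => b _; rewrite (axis_basis0 ET)// mulr0.
rewrite {1}(frame_decomposition (XM u) (Vfree Uu) (VT Uu) NT NN NV zv0) -dT.
have zvN : inner c (zv u) (N u) = nu u.
  rewrite /zv mulmx_sum_row inner_suml nuE; apply: eq_bigr => b _.
  by rewrite innerZl innerC [w u 0 b]mxE.
have zvX : c * inner c (zv u) (X u) = c * rho u.
  rewrite /zv mulmx_sum_row inner_suml rhoE !mulr_sumr; apply: eq_bigr => b _.
  by rewrite innerZl mulrCA (axis_coordE c x0) mulrCA.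
rewrite zvN zvX !innerDr !innerZr; congr (_ + _ + _).
  by rewrite /H /second_form mxE.
by rewrite mulrAC c_inner_partial2// mulNr mulrAC.
Qed.

Lemma mx_differentiable_omega u : U u -> mx_differentiable omega u.
Proof.
move=> Uu; apply: mx_differentiable_mul; last exact: mx_differentiable_invmetric.
by move=> i j; rewrite ord1; exact: (has_gradient_radial j Uu).1.
Qed.

Let gsym u i j : g u i j = g u j i.
Proof. by move/matrixP: (trmx_gram c (V u)) => /(_ j i); rewrite mxE. Qed.

Let Hsym u i j : U u -> H u i j = H u j i.
Proof. by move=> Uu; move/matrixP: (second_form_sym Uu) => /(_ j i); rewrite mxE. Qed.

Let PPsym u i j : (P u *m (P u)^T) i j = (P u *m (P u)^T) j i.
Proof. by rewrite -[in RHS](trmxK (P u)) -trmx_mul [RHS]mxE trmxK. Qed.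

Let omega_metric u : U u -> omega u *m g u = d u.
Proof. by move=> Uu; rewrite /omega mulmxKV// gunit. Qed.

(** This is twice the half Hessian of rho applied to [omega]: in the derivative of |omega|^2 those
    of the metric cancel the tangential terms. *)
Lemma has_gradient_radial_normsq u : U u -> has_gradient s u (fun i =>
  2 * ((omega u *m (P u *m (P u)^T)) 0 i + nu u * (omega u *m H u) 0 i
       - c * rho u * d u 0 i)).
Proof.
move=> Uu; have dom k := has_gradientP (mx_differentiable_omega Uu 0 k).
have -> : s = (fun v => \sum_k omega v 0 k * d v 0 k).
  by apply/funext => v; rewrite /s mxE; apply: eq_bigr => k _; rewrite [X in _ * X]mxE.
have := has_gradient_sum (index_enum 'I_n) (fun k =>
  has_gradientM (dom k) (has_gradient_radial k Uu)).
move=> h; apply: has_gradient_eq h _ => i.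
pose o k := omega u 0 k.
pose Do k := partial i (fun v => omega v 0 k) u.
pose XX k (y : 'rV[R]_n.+2) := inner c (partial i (partial k X) u) y.
pose Dd k := (P u *m (P u)^T) i k + XX k (zv u).
have dE l : d u 0 l = \sum_k o k * g u k l.
  by rewrite -(omega_metric Uu) mxE.
(* Differentiating omega g = d gives the derivatives of [omega] implicitly, without a formula for
   those of the inverse metric. *)
have DdE l : Dd l = \sum_k (Do k * g u k l
    + o k * (XX k (partial l X u) + XX l (partial k X u))).
  have same : \forall v \near u, \sum_k omega v 0 k * metric c X v k l = d v 0 l.
    apply: (@filterS _ (nbhs u) _ _ _ _ (nearU Uu)) => v Uv.
    by rewrite -(omega_metric Uv) mxE; apply: eq_bigr => k _; rewrite metric_gram.
  have gr := has_gradient_sum (index_enum 'I_n) (fun k =>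
    has_gradientM (dom k) (has_gradient_metric k l Uu)).
  have [_ gr'] := has_gradient_near same gr.
  rewrite /Dd /XX -((has_gradient_radial l Uu).2 i) (gr' i); apply: eq_bigr => k _.
  rewrite metric_gram; congr (_ + _ * (_ + _)); exact: innerC.
have XV k : XX k (omega u *m V u) = \sum_l o l * XX k (partial l X u).
  rewrite /XX mulmx_sum_row inner_sumr; apply: eq_bigr => l _.
  by rewrite innerZr rowK.
have oDd : \sum_k o k * Dd k = \sum_k Do k * d u 0 k + 2 * \sum_k o k * XX k (omega u *m V u).
  transitivity (\sum_k \sum_l (o k * (Do l * g u l k)
      + (o k * (o l * XX l (partial k X u)) + o k * (o l * XX k (partial l X u))))).
    apply: eq_bigr => k _; rewrite DdE mulr_sumr; apply: eq_bigr => l _.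
    move: (o k) (Do l) (g u l k) (o l) (XX l _) (XX k _) => a b e f x y; ring.
  under eq_bigr do rewrite !big_split/=.
  rewrite !big_split/=; congr (_ + _).
    rewrite exchange_big/=; apply: eq_bigr => l _; rewrite dE mulr_sumr.
    by apply: eq_bigr => k _; rewrite mulrCA gsym.
  rewrite mulrDl mul1r; congr (_ + _).
    rewrite exchange_big/=; apply: eq_bigr => l _; rewrite XV mulr_sumr.
    by apply: eq_bigr => k _; rewrite mulrCA.
  by apply: eq_bigr => k _; rewrite XV mulr_sumr.
have -> : \sum_k (Do k * d u 0 k + o k * Dd k) =
    2 * \sum_k o k * (Dd k - XX k (omega u *m V u)).
  under [in RHS]eq_bigr do rewrite mulrBr.
  rewrite big_split/= sumrB oDd; ring.
congr (2 * _).
have -> : (omega u *m (P u *m (P u)^T)) 0 i = \sum_k o k * (P u *m (P u)^T) i k.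
  by rewrite [LHS]mxE; apply: eq_bigr => k _; rewrite PPsym.
have -> : (omega u *m H u) 0 i = \sum_k o k * H u i k.
  by rewrite [LHS]mxE; apply: eq_bigr => k _; rewrite Hsym.
have -> : d u 0 i = \sum_k o k * g u i k.
  by rewrite dE; apply: eq_bigr => k _; rewrite gsym.
rewrite !mulr_sumr -big_split/= -sumrB; apply: eq_bigr => k _.
rewrite /Dd /XX radial_decomposition//; ring.
Qed.

Let sE u : U u -> s u = rho u - nu u ^+ 2 - c * rho u ^+ 2.
Proof. by move=> Uu; exact: rot_dgd (axis_gram Uu). Qed.

Let dPP u : U u -> rho u *: (omega u *m (P u *m (P u)^T)) =
  (rho u - nu u ^+ 2 - c * rho u ^+ 2) *: d u.
Proof. by move=> Uu; rewrite mulmxA; exact: rot_dgPP (axis_gram Uu) (axis_normal Uu). Qed.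

Let dH u : U u -> rho u != 0 ->
  rho u *: (omega u *m H u) = ((n%:R - 1) * nu u) *: d u.
Proof.
move=> Uu r0; exact: (rot_dgH (trmx_gram c (V u)) (gunit Uu) (second_form_sym Uu)
  (axis_gram Uu) (axis_normal Uu) r0 (Xmin Uu) (shape_eigen Uu)).
Qed.

Lemma sqnormA_axis u : U u -> rho u != 0 ->
  rho u ^+ 2 * sqnormA c X u = n%:R * (n%:R - 1) * nu u ^+ 2.
Proof.
move=> Uu r0; rewrite /sqnormA metric_gram.
exact: (rot_normA (trmx_gram c (V u)) (gunit Uu) (second_form_sym Uu)
  (axis_gram Uu) (axis_normal Uu) r0 (Xmin Uu) (shape_eigen Uu)).
Qed.

Lemma axis_normsq_eq0 u : rho u = 0 -> z u = 0.
Proof.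
move=> r0; apply/rowP => b; rewrite [RHS]mxE; apply/eqP; rewrite -sqrf_eq0.
have : \sum_a z u 0 a ^+ 2 = 0.
  by rewrite -[RHS]r0 rhoE; apply: eq_bigr => a _; exact: expr2.
by move/psumr_eq0P => -> // a _; exact: sqr_ge0.
Qed.

Lemma axis_normsq_ge0 u : 0 <= rho u.
Proof. by rewrite rhoE; apply: sumr_ge0 => b _; rewrite -expr2 sqr_ge0. Qed.

(** * The locally constant invariant and the value of |A| *)

Hypothesis n2 : (2 <= n)%N.

(* On the hypersurface this is nu^2 rho^(n-2), that is |A|^2 rho^n / (n (n - 1)). *)
Let phi u : R := (rho u - c * rho u ^+ 2 - s u) * rho u ^+ n.-2.

Lemma invariantE u : U u -> phi u = nu u ^+ 2 * rho u ^+ n.-2.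
Proof. by move=> Uu; rewrite /phi sE//; congr (_ * _); ring. Qed.

Lemma invariant_flat u : U u -> has_gradient phi u (fun=> 0).
Proof.
move=> Uu; have dr := has_gradient_axis_normsq Uu.
have pow m : is_derive (rho u) 1 (fun x : R => x ^+ m) (m%:R * rho u ^+ m.-1).
  by split; [exact: exprn_derivable | rewrite exp_derive; exact: mulr1].
have := has_gradientM (has_gradientB (has_gradientB dr
  (has_gradientZ c (has_gradient_comp (pow 2%N) dr))) (has_gradient_radial_normsq Uu))
  (has_gradient_comp (pow n.-2) dr).
move=> h; apply: has_gradient_eq h _ => i /=.
have /rowP/(_ i) := dPP Uu; rewrite [LHS]mxE [RHS]mxE.
(* On the axis z = 0, so d, omega and nu vanish and every term with them; elsewhere it suffices to
   check the equation times rho. *)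
have [r0|r0] := eqVneq (rho u) 0.
  move=> _; have zu := axis_normsq_eq0 r0.
  have du : d u = 0 by rewrite /d zu mul0mx.
  have ou : omega u = 0 by rewrite /omega du mul0mx.
  rewrite sE// r0 ou du !mul0mx !mxE /nu zu mul0mx mxE; ring.
have /rowP/(_ i) := dH Uu r0; rewrite [LHS]mxE [RHS]mxE sE//.
(* The factor rho restores the exponent n - 2; for n = 2, where the predecessor truncates, both
   sides are 0. *)
have pw : rho u * (n.-2%:R * rho u ^+ n.-2.-1) = n.-2%:R * rho u ^+ n.-2.
  by case: (n.-2) => [|m]; rewrite ?mul0r ?mulr0// exprS mulrCA.
have nE : n.-2%:R = n%:R - 2 :> R by rewrite -subn2 natrB.
move=> e1 e2; apply: (mulfI r0); rewrite mulr0; move: pw e1 e2; rewrite nE.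
move: (rho u) (nu u) (d u 0 i) ((omega u *m H u) 0 i) ((omega u *m (P u *m _)) 0 i).
move=> r v e B A; move: (r ^+ n.-2) (r ^+ n.-2.-1) => p1 p0 pw e1 e2.
transitivity (2 * p1 * (r * e - c * r ^+ 2 * e - r * A - v * (r * B))
   + v ^+ 2 * 2 * e * (r * ((n%:R - 2) * p0))); first by ring.
rewrite e1 e2 pw; ring.
Qed.

Lemma invariant_const u : U u -> \forall v \near u, U v /\ phi v = phi u.
Proof.
move=> Uu; have /nbhs_ballP[r/= r0 rU] := nearU Uu.
have B : \forall v \near u, ball u r v by apply/nbhs_ballP; exists r.
apply: (@filterS _ (nbhs u) _ _ _ _ B) => v bv; split; first exact: rU.
have := @small_partial_lipschitz R n phi u r 0 (lexx 0) _ _ v u bv (ballxx _ r0).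
rewrite mulr0 mul0r => le0; apply/eqP; rewrite -subr_eq0 -normr_le0; apply: le0.
  by move=> y /rU Uy; exact: (invariant_flat Uy).1.
by move=> y i /rU Uy; rewrite (invariant_flat Uy).2 normr0.
Qed.

(** For nu = 0 and trace 0, [rot_rank] reads H g^-1 H = 0, so the rows of H g^-1 V are tangent
    vectors of zero length. *)
Lemma shape_eq0 u : U u -> rho u != 0 -> nu u = 0 -> H u = 0.
Proof.
move=> Uu r0 nu0.
have [HH _] := rot_rank (trmx_gram c (V u)) (gunit Uu) (second_form_sym Uu)
  (axis_gram Uu) (axis_normal Uu) r0 (shape_eigen Uu).
have {}HH : H u *m invmx (g u) *m H u = 0.
  by move: HH; rewrite -/(nu u) nu0 mul0r scale0r addr0 (Xmin Uu) scale0r.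
apply/row_matrixP => i; rewrite row0; pose y := row i (H u) *m invmx (g u).
have yV : y *m V u = 0.
  apply: (tangent_eq0 (XM u)); first exact: mulmx_tangent (VT Uu).
  rewrite inner_mx trmx_mul !mulmxA -2!(mulmxA y) -/(gram c (V u)) -/(g u).
  rewrite /y trmx_mul trmx_inv trmx_gram mulmxA mulmxKV ?gunit//.
  by rewrite tr_row (second_form_sym Uu) -row_mul mulmx_row_col HH mxE.
have y0 : y = 0 by apply: (row_free_inj (Vfree Uu)); rewrite yV mul0mx.
by rewrite -[row i _](mulmxKV (gunit Uu)) -/y y0 mul0mx.
Qed.

Lemma partial2_coord0 u i j : U u -> c = 0 -> partial i (partial j X) u 0 0 = 0.
Proof.
move=> Uu c0; rewrite -((has_gradient_coord 0 (dXi j Uu)).2 i).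
have [_ cst0] := has_gradient_cst (0 : R) u; rewrite -[RHS](cst0 i).
apply: near_eq_partial; apply: (@filterS _ (nbhs u) _ _ _ _ (nearU Uu)) => v Uv.
apply: (tangent_coord0 c0 (x := X v)); rewrite -(rowK (fun i => partial i X v)).
exact: VT.
Qed.

(** Otherwise z and its derivatives P vanish at [u], and [axis_gram] says that the identity equals
    w^T w, of rank at most one, while n >= 2. *)
Lemma axis_nowhere_dense u : U u -> ~ (\forall v \near u, rho v = 0).
Proof.
move=> Uu r0; have zu : z u = 0 by apply: axis_normsq_eq0; exact: nbhs_singleton r0.
have Pu : P u = 0.
  apply/matrixP => i b; rewrite [RHS]mxE -((has_gradient_axis_coord b Uu).2 i).
  have [_ cst0] := has_gradient_cst (0 : R) u; rewrite -[RHS](cst0 i).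
  apply: near_eq_partial; apply: (@filterS _ (nbhs u) _ _ _ _ r0) => v rv.
  by rewrite axis_normsq_eq0// mxE.
have := axis_gram Uu; rewrite Pu zu !mulmx0 scaler0 subr0 => /esym/eqP.
rewrite subr_eq0 => /eqP ww; have := mxrankM_maxr (w u)^T (w u).
rewrite -ww mxrank1 => /leq_trans/(_ (rank_leq_row _)).
by rewrite leqNgt n2.
Qed.

(* Unlike N and H, which are only defined up to an arbitrary sign at each point,
   this vector depends continuously on the point. *)
Let normal_part i j u := partial i (partial j X) u
  - covector c (V u) (partial i (partial j X) u) *m invmx (g u) *m V u
  - (c *: (partial i (partial j X) u *m form_mx n c *m (X u)^T)) *m X u.

Lemma normal_partE i j u : U u -> normal_part i j u = H u i j *: N u.
Proof.
move=> Uu; have [NT NN NV] := NP Uu; rewrite /normal_part.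
have := frame_decomposition (XM u) (Vfree Uu) (VT Uu) NT NN NV (partial2_coord0 i j Uu).
have -> : c *: (partial i (partial j X) u *m form_mx n c *m (X u)^T) =
    (c * inner c (partial i (partial j X) u) (X u))%:M.
  by rewrite inner_mx -scale_scalar_mx; congr (_ *: _); exact: mx11_scalar.
rewrite mul_scalar_mx => {1}->.
have -> : inner c (partial i (partial j X) u) (N u) = H u i j.
  by rewrite /H /second_form [RHS]mxE.
by rewrite [_ + _ + _]addrAC addrK addrC addKr.
Qed.

Lemma mx_differentiable_normal_part i j u : U u -> mx_differentiable (normal_part i j) u.
Proof.
move=> Uu; have dij := mx_differentiable_row (dXij i j Uu).
apply: mx_differentiableB.
  apply: mx_differentiableB; first exact: dij.
  apply: mx_differentiable_mul; last exact: mx_differentiable_frame.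
  apply: mx_differentiable_mul; last exact: mx_differentiable_invmetric.
  exact: mx_differentiable_covector.
apply: mx_differentiable_mul; last exact: mx_differentiable_row (dX Uu).
have -> : (fun v => c *: (partial i (partial j X) v *m form_mx n c *m (X v)^T)) =
    (fun v => partial i (partial j X) v *m (c *: form_mx n c) *m (X v)^T).
  by apply/funext => v; rewrite -scalemxAr -scalemxAl.
apply: mx_differentiable_mul.
  by apply: mx_differentiable_mul => //; exact: mx_differentiable_cst.
by apply: mx_differentiable_tr; exact: mx_differentiable_row (dX Uu).
Qed.

(** Off the axis phi = 0 forces nu = 0 and H = 0. A nonzero entry of H at [u] would keep
    [normal_part] nonzero nearby, so a whole neighbourhood would lie on the axis. *)
Lemma normA_eq0 u : U u -> phi u = 0 -> normA c X u = 0.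
Proof.
move=> Uu phi0; suff H0 : H u = 0 by rewrite /normA /sqnormA -/(H u) H0 mulmx0 !mul0mx mxtrace0 sqrtr0.
apply/matrixP => i j; rewrite [RHS]mxE; apply: contrapT => Hij.
have [NT NN NV] := NP Uu.
have np : normal_part i j u != 0.
  rewrite normal_partE// scaler_eq0 negb_or; apply/andP; split; first exact/eqP.
  by apply: contra_eq_neq NN => ->; rewrite inner0l eq_sym oner_neq0.
have near0 := mx_differentiable_neq0 (mx_differentiable_normal_part i j Uu) np.
apply: (axis_nowhere_dense Uu).
apply: (@filterS _ (nbhs u) _ _ _ _ (@filterI _ (nbhs u) _ _ _ near0 (invariant_const Uu))).
move=> v [nv [Uv pv]]; apply: contrapT => /eqP rv; move/eqP: nv; apply.
rewrite normal_partE// shape_eq0 ?mxE ?scale0r//.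
move: pv; rewrite phi0 invariantE// => /eqP.
by rewrite mulf_eq0 expf_eq0 (negPf (expf_neq0 _ rv)) orbF /= => /eqP.
Qed.

(** * Simons' equation *)

Let f := normA c X.

Definition simons_at u :=
  [/\ differentiable f u, forall i, differentiable (partial i f) u &
   f u * laplacian c X f u + f u ^+ 4
   = 2 / n%:R * sqnorm_gradient c X f u + n%:R * c * f u ^+ 2].

Lemma near_ball u : U u -> exists2 r : R, 0 < r &
  forall v, ball u r v -> U v /\ phi v = phi u.
Proof. by move=> Uu; have /nbhs_ballP[r r0 h] := invariant_const Uu; exists r. Qed.

Let near_in_ball (u v : 'rV[R]_n) r : ball u r v -> \forall w \near v, ball u r w.
Proof. by move=> bv; exact: open_nbhs_nbhs (conj (ball_open u r) bv). Qed.

Lemma simons_zero u : U u -> phi u = 0 -> simons_at u.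
Proof.
move=> Uu phi0; have [r r0 rU] := near_ball Uu.
have f0 v : ball u r v -> has_gradient f v (fun=> 0).
  move=> bv; apply: has_gradient_near (has_gradient_cst (0 : R) v).
  apply: (@filterS _ (nbhs v) _ _ _ _ (near_in_ball bv)) => y by_.
  have [Uy py] := rU _ by_.
  by rewrite /f normA_eq0// py.
have fi i : \forall v \near u, 0 = partial i f v.
  apply: (@filterS _ (nbhs u) _ _ _ _ (near_in_ball (ballxx u r0))) => v bv.
  by rewrite (f0 v bv).2.
have fu : f u = 0 by rewrite /f normA_eq0.
split.
- exact: (f0 u (ballxx u r0)).1.
- by move=> i; exact: near_eq_differentiable (fi i) (differentiable_cst _ _).
- rewrite fu mul0r !expr0n/= mulr0 add0r addr0 /sqnorm_gradient /gradient.
  rewrite (_ : \row_j partial j f u = 0) ?mul0mx ?mxE ?mulr0//.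
  by apply/rowP => j; rewrite mxE [RHS]mxE (f0 u (ballxx u r0)).2.
Qed.

(** From |A|^2 = n (n - 1) nu^2 / rho^2 = n (n - 1) phi rho^(-n). The power -n/2 is written with
    [expR] and [ln] since n may be odd. *)
Lemma normA_local u v : U u -> U v -> phi v = phi u -> phi u != 0 ->
  rho v != 0 /\ f v = Num.sqrt (n%:R * (n%:R - 1) * phi u)
    * expR (- (n%:R / 2) * ln (rho v)).
Proof.
move=> Uu Uv pv p0.
have r0 : rho v != 0.
  apply: contra p0 => /eqP r0; rewrite -pv invariantE//.
  by rewrite /nu (axis_normsq_eq0 r0) mul0mx mxE expr0n mul0r.
split => //; have rp : 0 < rho v by rewrite lt_neqAle eq_sym r0 axis_normsq_ge0.
have pu0 : 0 <= phi u by rewrite -pv invariantE// mulr_ge0 ?sqr_ge0// exprn_ge0// ltW.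
have A0 : 0 <= n%:R * (n%:R - 1) * phi u :> R.
  by rewrite mulr_ge0// mulr_ge0// subr_ge0 ler1n ltnW.
set G := RHS; have G0 : 0 <= G by rewrite mulr_ge0 ?sqrtr_ge0// expR_ge0.
rewrite /f /normA -[RHS](ger0_norm G0) -sqrtr_sqr; congr Num.sqrt.
rewrite /G exprMn sqr_sqrtr// -expRM_natl.
have -> : 2%:R * (- (n%:R / 2) * ln (rho v)) = - (n%:R * ln (rho v)) :> R by field.
rewrite expRN expRM_natl lnK ?posrE//.
apply: (mulfI (expf_neq0 2 r0)); rewrite sqnormA_axis// -pv invariantE//.
have -> : rho v ^+ n = rho v ^+ 2 * rho v ^+ n.-2 by rewrite -exprD -subn2 subnKC.
have := expf_neq0 n.-2 r0; move: (rho v ^+ n.-2) r0 => p r0 pn; by field; rewrite r0 pn.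
Qed.

Lemma simons_pos u : U u -> phi u != 0 -> simons_at u.
Proof.
move=> Uu p0; have [r r0 rU] := near_ball Uu.
have fact v : ball u r v -> U v /\ rho v != 0.
  by move=> /rU[Uv pv]; have [] := normA_local Uu Uv pv p0.
have f1 v : ball u r v -> has_gradient f v
    (fun j => - n%:R * (f v * (d v 0 j * (rho v)^-1))).
  move=> bv; have [Uv rv] := fact v bv.
  have [_ pv] := rU v bv; have [_ fv] := normA_local Uu Uv pv p0.
  have rp : 0 < rho v by rewrite lt_neqAle eq_sym rv axis_normsq_ge0.
  have gr := has_gradientZ (Num.sqrt (n%:R * (n%:R - 1) * phi u))
    (has_gradient_comp (is_derive_expR (- (n%:R / 2) * ln (rho v)))
      (has_gradientZ (- (n%:R / 2)) (has_gradient_comp (is_derive1_ln rp)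
        (has_gradient_axis_normsq Uv)))).
  have same : \forall y \near v, Num.sqrt (n%:R * (n%:R - 1) * phi u)
      * expR (- (n%:R / 2) * ln (rho y)) = f y.
    apply: (@filterS _ (nbhs v) _ _ _ _ (near_in_ball bv)) => y by_.
    have [Uy py] := rU y by_; have [_ fy] := normA_local Uu Uy py p0.
    exact: esym.
  apply: has_gradient_eq (has_gradient_near same gr) _ => j.
  rewrite fv; move: (Num.sqrt _) (expR _) (d v 0 j) (rho v)^-1 => a e x y; by field.
have [Uu' ru] := fact u (ballxx u r0).
have [_ fi] := f1 u (ballxx u r0).
have dinv : is_derive (rho u) 1 (fun x : R => x^-1) (- (rho u) ^- 2).
  by apply: is_derive_eq (is_deriveV ru (is_derive_id (rho u) 1)) _; rewrite [LHS]mulr1.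
have f2 j := has_gradientZ (- n%:R) (has_gradientM (f1 u (ballxx u r0))
  (has_gradientM (has_gradient_radial j Uu) (has_gradient_comp dinv (has_gradient_axis_normsq Uu)))).
have fj j : \forall v \near u, - n%:R * (f v * (d v 0 j * (rho v)^-1)) = partial j f v.
  apply: (@filterS _ (nbhs u) _ _ _ _ (near_in_ball (ballxx u r0))) => v bv.
  by rewrite (f1 v bv).2.
have f2' j := has_gradient_near (fj j) (f2 j).
split; [exact: (f1 u (ballxx u r0)).1 | by move=> j; exact: (f2' j).1 |].
(* As d is half of d rho, the second derivative of rho^(-n/2) contributes 4 (n/2)(n/2 + 1) = n^2 + 2
   n; the last bracket is half the Hessian of rho. *)
have hessE : hessian c X f u = f u *: (((n%:R ^+ 2 + 2 * n%:R) / rho u ^+ 2) *: ((d u)^T *m d u)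
    - (n%:R / rho u) *: (P u *m (P u)^T + nu u *: H u - (c * rho u) *: g u)).
  apply/matrixP => i j; rewrite [LHS]mxE ((f2' j).2 i).
  have -> : \sum_k christoffel c X k i j u * partial k f u =
      - n%:R * f u / rho u * inner c (partial i (partial j X) u) (omega u *m V u).
    rewrite inner_mulmx [(_ *m (omega u)^T) 0 0](_ : _ =
      (covector c (V u) (partial i (partial j X) u) *m invmx (g u) *m (d u)^T) 0 0); last first.
      by rewrite /omega trmx_mul trmx_inv trmx_gram mulmxA.
    rewrite [(_ *m (d u)^T) 0 0]mxE mulr_sumr; apply: eq_bigr => k _.
    rewrite christoffelE// fi [(d u)^T _ _]mxE; move: (_ 0 k) (d u 0 k) (f u) (rho u)^-1 => a b e y; ring.
  rewrite radial_decomposition//.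
  have entry (a b k l e : R) (A B C D : 'M[R]_n) :
      (e *: (a *: A - b *: (B + k *: C - l *: D))) i j
      = e * (a * A i j - b * (B i j + k * C i j - l * D i j)) by rewrite !mxE.
  rewrite entry [((d u)^T *m d u) i j]mxE big_ord1 [(d u)^T _ _]mxE.
  move: (d u 0 i) (d u 0 j) ((P u *m (P u)^T) i j) (H u i j) (g u i j) (inner c _ _) ru.
  move: (nu u) (rho u) (f u) (n%:R : R) => nu' rho' f' n' di dj p h g' q r'.
  by field.
have n0 : n%:R != 0 :> R by rewrite pnatr_eq0 -lt0n ltnW.
have lapE : rho u ^+ 2 * laplacian c X f u = f u *
    ((n%:R ^+ 2 + 2 * n%:R) * s u - n%:R * rho u * (n%:R - c * rho u - c * rho u * n%:R)
      + n%:R * nu u ^+ 2).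
  have trd : \tr (invmx (g u) *m ((d u)^T *m d u)) = s u.
    by rewrite mulmxA mxtrace_mulC mulmxA trace_mx11.
  have trP : \tr (invmx (g u) *m (P u *m (P u)^T)) =
      n%:R - (w u *m (w u)^T) 0 0 - c * rho u.
    by rewrite mulmxA mxtrace_mulC mulmxA; exact: rot_trace (axis_gram Uu).
  have trg : \tr (invmx (g u) *m g u) = n%:R by rewrite mulVmx ?gunit// mxtrace1.
  have tr (a b k l e : R) (G A B C D : 'M[R]_n) :
      \tr (G *m (e *: (a *: A - b *: (B + k *: C - l *: D))))
      = e * (a * \tr (G *m A) - b * (\tr (G *m B) + k * \tr (G *m C) - l * \tr (G *m D))).
    rewrite -scalemxAr mulmxBr -!scalemxAr mulmxBr mulmxDr -!scalemxAr.
    by rewrite mxtraceZ raddfB /= mxtraceZ mxtraceZ raddfB raddfD /= !mxtraceZ.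
  have ww : rho u * (w u *m (w u)^T) 0 0 = nu u ^+ 2 := rot_ww (axis_normal Uu).
  rewrite /laplacian hessE metric_gram tr trd trP trg Xmin// -ww.
  move: ((w u *m (w u)^T) 0 0) {ww} ru => ww.
  move: (s u) (rho u) (f u) (n%:R : R) => s' rho' f' n' r'.
  by field.
have gradE : gradient c X f u = (- n%:R * f u / rho u) *: omega u.
  rewrite /gradient metric_gram /omega scalemxAl; congr (_ *m _).
  apply/rowP => j; rewrite [LHS]mxE fi [RHS]mxE.
  by move: (d u 0 j) (rho u)^-1 => a b; ring.
have sqE : rho u ^+ 2 * sqnorm_gradient c X f u = n%:R ^+ 2 * f u ^+ 2 * s u.
  rewrite /sqnorm_gradient metric_gram gradE -!scalemxAl omega_metric// linearZ/= -scalemxAr scalerA.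
  rewrite [X in _ * X]mxE [(d u *m _) 0 0](_ : _ = s u); last first.
    by rewrite /s /omega trmx_mul trmx_inv trmx_gram mulmxA.
  by move: (s u) (rho u) ru => s' rho' r'; field.
have [_ fu] := normA_local Uu Uu erefl p0.
(* [Num.sqrt] is 0 on negative numbers, so the sign of [sqnormA] must be known; it is read off
   [sqnormA_axis]. *)
have ff : f u ^+ 2 = sqnormA c X u.
  rewrite /f /normA sqr_sqrtr//; apply: contraT; rewrite -ltNge => sn.
  have : 0 <= rho u ^+ 2 * sqnormA c X u.
    by rewrite sqnormA_axis// mulr_ge0 ?sqr_ge0// mulr_ge0// subr_ge0 ler1n ltnW.
  by rewrite pmulr_rge0 ?exprn_even_gt0// leNgt sn.
have nuq : rho u ^+ 2 * f u ^+ 2 = n%:R * (n%:R - 1) * nu u ^+ 2 by rewrite ff sqnormA_axis.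
(* Multiplying by n rho^2 clears the denominators, so that [lapE], [sqE] and [nuq] apply and a
   polynomial identity remains. *)
apply: (mulfI (mulf_neq0 n0 (expf_neq0 2 ru))).
move: lapE sqE nuq; rewrite (sE Uu).
move: (laplacian _ _ _ _) (sqnorm_gradient _ _ _ _) (f u) (rho u) (nu u) (n%:R : R) n0 =>
  L S f' r' v m n0 lE sE' nE.
have -> : m * r' ^+ 2 * (f' * L + f' ^+ 4) =
   m * f' * (r' ^+ 2 * L) + m * f' ^+ 2 * (r' ^+ 2 * f' ^+ 2) by ring.
have -> : m * r' ^+ 2 * (2 / m * S + m * c * f' ^+ 2) =
   2 * (r' ^+ 2 * S) + m ^+ 2 * c * f' ^+ 2 * r' ^+ 2 by field.
rewrite lE sE' nE; ring.
Qed.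

Lemma simons_on_chart u : U u -> simons_at u.
Proof. by move=> Uu; have [/(simons_zero Uu)|/(simons_pos Uu)] := eqVneq (phi u) 0. Qed.

End LocalRotation.

Theorem proposition3p4 (R : realType) (n : nat) (hn : (2 <= n)%N) (c : R)
    (M : manifold R n) (F : M -> 'rV[R]_n.+2) :
  catenoid c F -> simons_equation c F.
Proof.
move=> [[Fhyp Fmin [_ [x0 [v0 [Mx0 Tv0 v1 ->]]] Frot]] _].
have [E [ET Ev EE]] := exists_orthonormal v0 Mx0.
move=> k ak X; have U_open : open (chart_img k) by case: (atlas_chart ak).
have [Xsmooth Xfree] := Fhyp.2 k ak.
have XM u : space_form c (X u) by exact: Fhyp.1.
have Xmin u : chart_img k u ->
    \tr (invmx (gram c (\matrix_(i < n) partial i X u)) *m second_form c X u) = 0.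
  by move=> Uu; rewrite -(metric_gram c X u); exact: Fmin Uu.
have XK u a b : chart_img k u -> a != b ->
    (X u *m axis_killing c x0 E a b <= \matrix_(i < n) partial i X u)%MS.
  move=> Uu ab.
  exact: (killing_tangent Fhyp Mx0 Tv0 ET Ev EE Frot ak ab Uu).
have simons u : chart_img k u -> simons_at c X u.
  move=> Uu; exact: (simons_on_chart U_open Xsmooth XM Xfree Xmin ET EE XK hn Uu).
split; last by move=> u /simons[].
case=> [|i [|j s]]; last by [].
  by move=> _ u Uu; have [df _ _] := simons u Uu; exact: df.
by move=> _ u Uu; have [_ df _] := simons u Uu; exact: df.
Qed.
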